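(* Let $p$ be a prime, $k\in\mathbb{N}$, $a\in[p-1]$, $b\in[a]$, and let $l_1,\dots,l_b$ be integers with $1\le l_1<l_2<\cdots<l_b\le k$. Let $\underline{\mathbf{u}}=(\mathsf{u}^1,\dots,\mathsf{u}^a)$ with $\mathsf{u}^i\in\{0,1\}^k$ for each $i$, and let $\phi(\underline{\mathbf{u}})$ be a corresponding linear character of $P_{ap^k}$. Let $g\in\mathfrak{S}_{ap^k}$ be an element whose disjoint cycles have lengths $p^{l_1},p^{l_2},\dots,p^{l_b}$, with all remaining points fixed, and let $\mathbf{C}$ be the centraliser of $g$ in $\mathfrak{S}_{ap^k}$. Then $$\frac{|P_{ap^k}|}{|\mathbf{C}|}\cdot\phi(\underline{\mathbf{u}})\uparrow_{P_{ap^k}}^{\mathfrak{S}_{ap^k}}(g)= \sum_{\nu\in\operatorname{Part}([b])} (-1)^{b-|\nu|}\cdot p^{k|\nu|}\cdot \prod_{\tau\in\nu}\left[ M(\tau)\cdot \sum_{i=1}^a \Big( \prod_{t\in\tau} C_{t}(i)\Big) \right].$$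
   Context: $[m]=\{1,\dots,m\}$; $\mathfrak{S}_n$ is the symmetric group on $[n]$; characters are complex; $\operatorname{Part}(A)$ is the set of set partitions of $A$, and $|\nu|$ is the number of blocks of $\nu$. Sylow subgroups: $P_p\le\mathfrak{S}_p$ is cyclic of order $p$, and for $k\ge 2$, $P_{p^k}=P_{p^{k-1}}\wr P_p=(P_{p^{k-1}})^{\times p}\rtimes P_p\le \mathfrak{S}_{p^k}$ (imprimitive action); $P_{ap^k}=P_{p^k}\times\cdots\times P_{p^k}$ ($a$ factors, acting on $a$ disjoint blocks of size $p^k$), a Sylow $p$-subgroup of $\mathfrak{S}_{ap^k}$. Linear characters: for linear characters $\phi$ of $P_{p^{k-1}}$ and $\psi$ of $P_p$, $\mathcal{X}(\phi;\psi)$ is the linear character $(g_1,\dots,g_p;h)\mapsto\phi(g_1)\cdots\phi(g_p)\psi(h)$ of $P_{p^k}$. Recursively $\mathcal{X}(\phi_1)=\phi_1$ and $\mathcal{X}(\phi_1,\dots,\phi_k)=\mathcal{X}(\mathcal{X}(\phi_1,\dots,\phi_{k-1});\phi_k)$, for linear characters $\phi_i$ of $P_p$; every linear character of $P_{p^k}$ is uniquely of this form. For $\underline{\mathbf{u}}=(\mathsf{u}^1,\dots,\mathsf{u}^a)$ with $\mathsf{u}^i\in\{0,1\}^k$, $\phi(\underline{\mathbf{u}})$ denotes any linear character $\mathcal{X}(\psi_{1,1},\dots,\psi_{1,k})\times\cdots\times\mathcal{X}(\psi_{a,1},\dots,\psi_{a,k})$ of $P_{ap^k}$ such that, for all $i,j$,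 $\mathsf{u}^i_j=1$ if and only if $\psi_{i,j}$ is trivial (the claim holds for every such choice). For $\mathsf{u}\in\{0,1\}^k$ and $l\in[k]$, $C_l(\mathsf{u}) := p^{\frac{p^l-1}{p-1}-2l}\cdot\prod_{m=1}^l(p\mathsf{u}_m-1)$; for $t\in[b]$ and $i\in[a]$, $C_t(i):=C_{l_t}(\mathsf{u}^i)$. Put $p_j:=p^{l_j}$. For $\tau=\{t_1<t_2<\cdots<t_z\}\subseteq[b]$ nonempty, $M(\tau):=p_{t_z}(p_{t_z}+p_{t_{z-1}})\cdots(p_{t_z}+\cdots+p_{t_2})$ if $z\ge2$, and $M(\tau):=1$ if $z=1$. *)

(* Defs.v *)
From mathcomp Require Import all_boot all_order all_algebra all_fingroup.
From mathcomp Require Import all_solvable all_field all_character.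

Set Implicit Arguments.
Unset Strict Implicit.
Unset Printing Implicit Defensive.

Import Order.TTheory GRing.Theory Num.Theory.
Local Open Scope ring_scope.

(* The linear character of G given by a function f that is multiplicative on  *)
(* G; it is 0 when f, cut off outside G, is not even a class function.        *)
Section LinearCharacterOfFunction.

Variables (gT : finGroupType) (G : {group gT}) (f : gT -> algC).

Definition cfLin : 'CF(G) := insubd (0 : 'CF(G)) [ffun x => f x *+ (x \in G)].

Hypothesis f1 : f 1%g = 1.
Hypothesis fM : {in G &, {morph f : x y / (x * y)%g >-> x * y}}.

Lemma cfLinE : {in G, cfLin =1 f}.
Proof.
have fJ : is_class_fun <<G>>%g [ffun x => f x *+ (x \in G)].
  rewrite genGid; apply: intro_class_fun => [x y Gx Gy | x /negPf-> //].
  rewrite groupJ // Gx /conjg !fM ?groupM ?groupV // mulrCA -fM ?groupV //.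
  by rewrite mulVg f1 mulr1.
move=> x Gx; rewrite /fun_of_cfun /cfLin.
have -> : cfun_val (insubd (0 : 'CF(G)) [ffun x => f x *+ (x \in G)]) =
          [ffun x => f x *+ (x \in G)] by apply: (insubdK (0 : 'CF(G))).
by rewrite ffunE Gx.
Qed.

Lemma cfLin_lin_char : cfLin \is a linear_char.
Proof.
have fP : mx_repr G (fun x => (f x)%:M : 'M[algC]_1).
  by split=> [|x y Gx Gy]; rewrite ?f1 // fM // scalar_mxM.
have -> : cfLin = cfRepr (MxRepresentation fP).
  by apply/cfun_inP=> x Gx; rewrite cfLinE // cfunE Gx /= mxtrace_scalar.
by apply/andP; split; rewrite ?cfRepr_char // cfRepr1.
Qed.

End LinearCharacterOfFunction.

(* Throughout, 'I_N is cut into q consecutive blocks of length m; the point   *)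
(* x of the block i is i * m + x.                                             *)
Section Wreath.

Variables (q m N : nat) (eN : N = (q * m)%N).

Fact block_subproof (i : 'I_q) (x : 'I_m) : (i * m + x < N)%N.
Proof.
rewrite eN; apply: (@leq_trans (i.+1 * m)); last by rewrite leq_mul2r ltn_ord orbT.
by rewrite mulSn addnC ltn_add2r.
Qed.
Definition block i x : 'I_N := Ordinal (block_subproof i x).

Fact block_index_subproof (y : 'I_N) : (y %/ m < q)%N.
Proof.
have := ltn_ord y; rewrite [X in (_ < X)%N]eN.
by case: (posnP m) => [->|m0]; rewrite ?muln0 // ltn_divLR.
Qed.
Definition block_index y : 'I_q := Ordinal (block_index_subproof y).

Fact block_offset_subproof (y : 'I_N) : (y %% m < m)%N.
Proof.
by have := ltn_ord y; rewrite [X in (_ < X)%N]eN ltn_mod; case: m; rewrite ?muln0.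
Qed.
Definition block_offset y : 'I_m := Ordinal (block_offset_subproof y).

Lemma blockK y : block (block_index y) (block_offset y) = y.
Proof. by apply: val_inj; rewrite /= -divn_eq. Qed.

Lemma block_indexK i x : block_index (block i x) = i.
Proof.
apply: val_inj => /=; have m0 : (0 < m)%N by case: x => x /=; case: m.
by rewrite divnMDl // divn_small ?addn0.
Qed.

Lemma block_offsetK i x : block_offset (block i x) = x.
Proof. by apply: val_inj; rewrite /= modnMDl modn_small. Qed.

Definition wr_fun (g : {ffun 'I_q -> 'S_m}) (h : 'S_q) (y : 'I_N) : 'I_N :=
  block (h (block_index y)) (g (block_index y) (block_offset y)).

Fact wr_fun_inj g h : injective (wr_fun g h).
Proof.
move=> y z e; rewrite -[y]blockK -[z]blockK.
have ei : block_index y = block_index z.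
  by apply: (@perm_inj _ h); have := congr1 block_index e; rewrite !block_indexK.
have := congr1 block_offset e; rewrite !block_offsetK ei => /perm_inj ->.
by [].
Qed.

(* The element (g_1, ..., g_q; h) of the wreath product in its imprimitive    *)
(* action: it moves the point x of the block i to the point g_i x of the      *)
(* block h i.                                                                 *)
Definition wr_perm g h : 'S_N := perm (@wr_fun_inj g h).

Lemma wr_permE g h i x : wr_perm g h (block i x) = block (h i) (g i x).
Proof. by rewrite permE /wr_fun block_indexK block_offsetK. Qed.

Lemma wr_perm1 : wr_perm [ffun=> 1%g] 1 = 1%g.
Proof.
by apply/permP=> y; rewrite -[y]blockK wr_permE ffunE !perm1.
Qed.

Lemma wr_permM g1 h1 g2 h2 :
  (wr_perm g1 h1 * wr_perm g2 h2)%g =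
  wr_perm [ffun i => g1 i * g2 (h1 i)]%g (h1 * h2).
Proof.
by apply/permP=> y; rewrite -[y]blockK permM !wr_permE ffunE !permM.
Qed.

Lemma wr_perm_inj g1 h1 g2 h2 : (0 < m)%N ->
  wr_perm g1 h1 = wr_perm g2 h2 -> g1 = g2 /\ h1 = h2.
Proof.
move=> m0 /permP e.
have eb i x : h1 i = h2 i /\ g1 i x = g2 i x.
  have := e (block i x); rewrite !wr_permE => eq_b.
  by split; [have := congr1 block_index eq_b | have := congr1 block_offset eq_b];
     rewrite ?block_indexK ?block_offsetK.
split; last by apply/permP=> i; case: (eb i (Ordinal m0)).
by apply/ffunP=> i; apply/permP=> x; case: (eb i x).
Qed.

Variables (G : {group 'S_m}) (H : {group 'S_q}).

Definition wreath_set : {set 'S_N} :=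
  [set wr_perm gh.1 gh.2 | gh : {ffun 'I_q -> 'S_m} * 'S_q
                         & (gh.1 \in ffun_on G) && (gh.2 \in H)].

Lemma wreathP s :
  reflect (exists (g : {ffun 'I_q -> 'S_m}) (h : 'S_q),
             [/\ forall i, g i \in G, h \in H & s = wr_perm g h])
          (s \in wreath_set).
Proof.
apply: (iffP imsetP) => [[[g h]]|[g [h [Gg Hh ->]]]].
  by rewrite inE /= => /andP[/ffun_onP Gg Hh] ->; exists g, h.
by exists (g, h); rewrite // inE /= Hh andbT; apply/ffun_onP.
Qed.

Fact wreath_group_set : group_set wreath_set.
Proof.
apply/group_setP; split.
  apply/wreathP; exists [ffun=> 1%g], 1%g.
  by split=> // [i|]; rewrite ?ffunE // wr_perm1.
move=> _ _ /wreathP[g1 [h1 [Gg1 Hh1 ->]]] /wreathP[g2 [h2 [Gg2 Hh2 ->]]].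
apply/wreathP; rewrite wr_permM.
exists [ffun i => g1 i * g2 (h1 i)]%g, (h1 * h2)%g.
by split=> // [i|]; rewrite ?ffunE groupM.
Qed.
Canonical wreath := Group wreath_group_set.

(* The function (g_1, ..., g_q; h) |-> phi_1(g_1) ... phi_q(g_q) psi(h); the  *)
(* decomposition of s is unique as soon as the blocks are nonempty.           *)
Definition wr_val (phi : 'I_q -> 'CF(G)) (psi : 'CF(H)) (s : 'S_N) : algC :=
  if [pick gh : {ffun 'I_q -> 'S_m} * 'S_q | s == wr_perm gh.1 gh.2] is Some gh
  then (\prod_i phi i (gh.1 i)) * psi gh.2 else 0.

Lemma wr_valE phi psi g h : (0 < m)%N ->
  wr_val phi psi (wr_perm g h) = (\prod_i phi i (g i)) * psi h.
Proof.
move=> m0; rewrite /wr_val; case: pickP => [[g' h'] /= /eqP e|/(_ (g, h))].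
  by have [-> ->] := wr_perm_inj m0 e.
by rewrite /= eqxx.
Qed.

Definition cfWreath phi psi : 'CF(wreath) := cfLin wreath (wr_val phi psi).

Section CfWreathTheory.

Variables (phi : 'I_q -> 'CF(G)) (psi : 'CF(H)).
Hypotheses (m_gt0 : (0 < m)%N) (lin_psi : psi \is a linear_char).
Hypothesis lin_phi : forall i, phi i \is a linear_char.
(* The phi_i have to agree along the orbits of H.                             *)
Hypothesis phiH : forall h i, h \in H -> phi (h i) = phi i.

Let wr_val1 : wr_val phi psi 1%g = 1.
Proof.
rewrite -wr_perm1 wr_valE // lin_char1 // mulr1 big1 // => i _.
by rewrite ffunE lin_char1.
Qed.

Let wr_valM :
  {in wreath &, {morph wr_val phi psi : x y / (x * y)%g >-> x * y}}.
Proof.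
move=> _ _ /wreathP[g1 [h1 [Gg1 Hh1 ->]]] /wreathP[g2 [h2 [Gg2 Hh2 ->]]].
rewrite wr_permM !wr_valE // lin_charM // mulrACA; congr (_ * _).
rewrite [X in _ = _ * X](reindex_inj (@perm_inj _ h1)) -big_split /=.
by apply: eq_bigr => i _; rewrite ffunE lin_charM // phiH.
Qed.

Lemma cfWreathE (g : {ffun 'I_q -> 'S_m}) (h : 'S_q) : (forall i, g i \in G) -> h \in H ->
  cfWreath phi psi (wr_perm g h) = (\prod_i phi i (g i)) * psi h.
Proof.
move=> Gg Hh; rewrite cfLinE ?wr_valE //.
by apply/wreathP; exists g, h.
Qed.

Lemma cfWreath_lin_char : cfWreath phi psi \is a linear_char.
Proof. exact: cfLin_lin_char. Qed.

End CfWreathTheory.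

End Wreath.

Section SylowSubgroups.

Variable p : nat.

(* P_p, generated by the p-cycle i |-> i + 1 mod p.                           *)
Definition Psyl1 : {group 'S_p} := <[perm (@ordS_inj p)]>%G.

(* P_{p^k}; Psyl 1 is Psyl1, as p ^ 1 is convertible to p, and Psyl 0 is      *)
(* trivial.                                                                   *)
Fixpoint Psyl (k : nat) : {group 'S_(p ^ k)} :=
  match k with
  | 0 => 1%G
  | k1.+1 =>
    match k1 return {group 'S_(p ^ k1)} -> {group 'S_(p ^ k1.+1)} with
    | 0 => fun=> Psyl1
    | k2.+1 => fun G => wreath (expnS p k2.+1) G Psyl1
    end (Psyl k1)
  end.

(* X(psi_1, ..., psi_k), where psi_j is the entry of index j - 1 of psi.      *)
Fixpoint cfX (psi : seq 'CF(Psyl1)) (k : nat) : 'CF(Psyl k) :=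
  match k with
  | 0 => 1
  | k1.+1 =>
    match k1 return 'CF(Psyl k1) -> 'CF(Psyl k1.+1) with
    | 0 => fun=> nth 1 psi 0
    | k2.+1 => fun phi =>
        cfWreath (expnS p k2.+1) (fun=> phi) (nth 1 psi k2.+1)
    end (cfX psi k1)
  end.

Lemma cfX_lin_char psi k : (0 < p)%N ->
  all (fun chi : 'CF(Psyl1) => chi \is a linear_char) psi ->
  cfX psi k \is a linear_char.
Proof.
move=> p0 lin_psi; have lin_nth j : nth 1 psi j \is a linear_char.
  have [ltj|gej] := ltnP j (size psi); first exact: (allP lin_psi _ (mem_nth _ _)).
  by rewrite nth_default // cfun1_lin_char.
elim: k => [|[|k] IHk]; rewrite ?cfun1_lin_char //; first exact: lin_nth.
by apply: cfWreath_lin_char => //; [rewrite expn_gt0 p0 | exact: lin_nth].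
Qed.

(* P_{a p^k}: with a trivial top group, the wreath product is the direct      *)
(* product of a copies of P_{p^k} acting on the a blocks of length p^k.       *)
Definition PsylM (a k : nat) : {group 'S_(a * p ^ k)} :=
  wreath (erefl (a * p ^ k)%N) (Psyl k) 1%G.

(* X(psi_{1,1}, ..., psi_{1,k}) x ... x X(psi_{a,1}, ..., psi_{a,k}).         *)
Definition cfXM (a k : nat) (psi : 'I_a -> k.-tuple 'CF(Psyl1)) :
    'CF(PsylM a k) :=
  cfWreath (erefl (a * p ^ k)%N) (fun i => cfX (psi i) k) (1 : 'CF(1%G)).

Lemma cfXM_lin_char a k (psi : 'I_a -> k.-tuple 'CF(Psyl1)) : (0 < p)%N ->
  (forall i j, tnth (psi i) j \is a linear_char) ->
  cfXM psi \is a linear_char.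
Proof.
move=> p0 lin_psi; apply: cfWreath_lin_char => [||i|h i /set1P->].
- by rewrite expn_gt0 p0.
- exact: cfun1_lin_char.
- by apply: cfX_lin_char => //; apply/all_tnthP.
- by rewrite perm1.
Qed.

End SylowSubgroups.

(* C_l(u), u_m being the entry of index m - 1 of u. The quotient by p - 1 is  *)
(* exact; the exponent of p is an integer and may be negative.                *)
Definition Cval (p : nat) (u : seq bool) (l : nat) : algC :=
  (p%:R : algC) ^ (((p ^ l - 1) %/ (p - 1))%N%:Z - (2 * l)%N%:Z) *
  \prod_(m < l) (p%:R * (nth false u m)%:R - 1).

(* M(tau): one factor p_{t_z} + ... + p_{t_j} for each t_j in tau other than  *)
(* the least element t_1.                                                     *)
Definition Mval (p b : nat) (l : 'I_b -> nat) (tau : {set 'I_b}) : nat :=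
  \prod_(t in tau | [exists s in tau, (s < t)%N])
     \sum_(s in tau | (t <= s)%N) p ^ l s.

(* The lengths of the nontrivial disjoint cycles of g, with multiplicity.     *)
Definition cycle_lengths (n : nat) (g : 'S_n) : seq nat :=
  [seq #|X| | X : {set 'I_n} <- enum (porbits g) & (1 < #|X|)%N].

(* Main.v *)
Require Import Defs.
From mathcomp Require Import all_boot all_order all_algebra all_fingroup.
From mathcomp Require Import all_solvable all_field all_character.
From mathcomp Require Import ring.

(* Up to the factor |P| / |C|, the induced character at g is the sum of phi   *)
(* over the h in P_{a p^k} with the cycle type of g. On one factor P_{p^k},   *)
(* the sum S(T) of X(psi_1, ..., psi_k) over the elements whose nontrivial    *)
(* cycles have the lengths p^(l_t), t in T, equals                            *)
(*   \prod_(t in T) C_(l_t) * (p^k - \sum_(s in T, s > t) p^(l_s)).           *)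
(* This goes by induction on k. The elements of P_{p^k} wr P_p with trivial   *)
(* top component contribute a sum, over the maps T -> {1, ..., p}, of         *)
(* products of values of S for k, which collapses to the same formula for     *)
(* k + 1. The other elements have no fixed points, so they only matter for    *)
(* T = {t} with l_t = k + 1; they are then the elements whose cycle product   *)
(* is a full cycle, and the cycle product is equidistributed over P_{p^k}.    *)
(* Hence the left hand side is a sum over f : [b] -> [a] of                   *)
(*   \prod_t C_t(f t) * (p^k - \sum_(s > t, f s = f t) p^(l_s)),              *)
(* and expanding the last product, one point t at a time in decreasing order, *)
(* gives a signed sum over the partitions of [b] on whose blocks f is         *)
(* constant, with the weights M(tau).                                         *)

(** The passage from the induced character to a sum over a conjugacy class is [cfInd_sum_class];
    [eq_ncycles_conj] identifies the class with a cycle type. The sums S(T) are evaluated in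
    [sum_cycle_type_cfX].

    Its inductive step rests on three facts. Distinct powers of p below p^(k+1) sum to less than
    p^(k+1), so an element without fixed points cannot have only such cycles
    ([sum_cycle_type_wreath_lt]). The sum of a linear character psi over the nontrivial elements of
    P_p is p - 1 or -1 according as psi is trivial or not, and this is the new factor of C_(k+1)
    ([sum_full_cycle_wreath], [CvalS]). Finally, a cycle of length p^(k+1) leaves room for no other,
    and the closed formula then vanishes too ([tail_prod_full_cycle]).

    The collapse of the sum over maps is [sum_tail_prod]; the expansion into set partitions is
    [sum_partition_block_weight], summed over all maps in [sum_partition_tail_prod]. *)

Set Implicit Arguments.
Unset Strict Implicit.
Unset Printing Implicit Defensive.

Import Order.TTheory GRing.Theory Num.Theory.
Local Open Scope ring_scope.

(** * Set partitions *)

Section PartitionInsert.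

Variables (T : finType) (t0 : T) (A : {set T}).
Hypothesis t0A : t0 \notin A.

(** These are mutually inverse between partitions of [A] with a marked block and partitions of
    [t0 |: A] in which [t0] is not alone. [remove_point] also returns the shortened block, which is
    the mark. *)
Let insert_block (x : {set {set T}} * {set T}) := (t0 |: x.2) |: x.1 :\ x.2.
Let remove_point (nu : {set {set T}}) :=
  let B := pblock nu t0 in ((B :\ t0) |: nu :\ B, B :\ t0).

Let notin_block nu B : partition nu A -> B \in nu -> t0 \notin B.
Proof.
by move=> nuA Bnu; apply: contra t0A; apply/subsetP; apply: partitionS nuA Bnu.
Qed.

Let block_t0 nu : partition nu (t0 |: A) -> [set t0] \notin nu ->
  [/\ pblock nu t0 \in nu, t0 \in pblock nu t0 & pblock nu t0 :\ t0 != set0].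
Proof.
move=> nuA nu0; have cov0 : t0 \in cover nu by rewrite (cover_partition nuA) setU11.
have [Bnu tB] := (pblock_mem cov0, etrans (mem_pblock nu t0) cov0).
split=> //; apply: contraNneq nu0 => B0.
by move: Bnu; rewrite -[pblock nu t0](setD1K tB) B0 setU0.
Qed.

Let remove_pointP nu : partition nu (t0 |: A) -> [set t0] \notin nu ->
  partition (remove_point nu).1 A.
Proof.
move=> nuA nu0; have [Bnu tB C0] := block_t0 nuA nu0.
have BA := partitionS nuA Bnu.
rewrite (_ : A = (pblock nu t0 :\ t0) :|: (t0 |: A) :\: pblock nu t0); last first.
  apply/setP=> x; rewrite !inE; case: (eqVneq x t0) => [->|xt0] /=.
    by rewrite tB (negPf t0A).
  case xB: (x \in pblock nu t0) => //=.
  by move/subsetP/(_ x xB): BA; rewrite !inE (negPf xt0).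
apply: partitionU1; rewrite ?partitionD1 //.
by rewrite -setI_eq0; apply/eqP/setP=> x; rewrite !inE; case: (x \in pblock _ _); rewrite ?andbF.
Qed.

Let remove_pointK nu : partition nu (t0 |: A) -> [set t0] \notin nu ->
  insert_block (remove_point nu) = nu.
Proof.
move=> nuA nu0; have [Bnu tB C0] := block_t0 nuA nu0.
rewrite /insert_block /= setD1K // setU1K ?setD1K //.
rewrite !inE; apply/negP=> /andP[neqCB Cnu].
(* If the shortened block were already in [nu], its point [x] would lie in two different blocks. *)
have [x xC] := set0Pn _ C0.
have tI := partition_trivIset nuA.
have := def_pblock tI Cnu xC; have xB : x \in pblock nu t0 by move: xC; rewrite inE => /andP[].
by rewrite (def_pblock tI Bnu xB) => e; rewrite -e eqxx in neqCB.
Qed.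

Let insert_blockP nu B : partition nu A -> B \in nu ->
  [&& partition (insert_block (nu, B)) (t0 |: A),
      [set t0] \notin insert_block (nu, B) &
      remove_point (insert_block (nu, B)) == (nu, B)].
Proof.
move=> nuA Bnu; have tB := notin_block nuA Bnu.
have B0 := partition_neq0 nuA Bnu.
have partI : partition (insert_block (nu, B)) (t0 |: A).
  rewrite (_ : t0 |: A = (t0 |: B) :|: A :\: B).
    apply: partitionU1; rewrite ?partitionD1 //.
      by apply/set0Pn; exists t0; rewrite setU11.
    rewrite -setI_eq0; apply/eqP/setP=> x; rewrite !inE.
    case: eqVneq => [->|_] /=; first by rewrite (negPf t0A) andbF.
    by case: (x \in B).
  apply/setP=> x; rewrite !inE; case: (x == t0) => //=.
  by case xB: (x \in B) => //=; rewrite (subsetP (partitionS nuA Bnu)).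
have pbE : pblock (insert_block (nu, B)) t0 = t0 |: B.
  by apply: def_pblock (partition_trivIset partI) _ _; rewrite setU11.
apply/and3P; split=> //.
  rewrite !inE negb_or; apply/andP; split; last first.
    by apply/andP=> -[_ /(notin_block nuA)]; rewrite inE eqxx.
  apply: contraNneq tB => e; have [x xB] := set0Pn _ B0.
  have: x \in [set t0] by rewrite e !inE xB orbT.
  by move/set1P=> <-.
have tBnu : t0 |: B \notin nu :\ B.
  by rewrite inE; apply/andP=> -[_ /(notin_block nuA)]; rewrite setU11.
by rewrite /remove_point pbE /insert_block /= !setU1K ?setD1K.
Qed.

Lemma sum_partitionU1 (R : nmodType) (Z : {set {set T}} -> R) :
  \sum_(nu | partition nu (t0 |: A)) Z nu =
  \sum_(nu | partition nu A)
     (Z ([set t0] |: nu) + \sum_(B in nu) Z ((t0 |: B) |: nu :\ B)).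
Proof.
rewrite (bigID (fun nu : {set {set T}} => [set t0] \in nu)) big_split /=; congr (_ + _).
  rewrite (reindex_onto (fun nu => [set t0] |: nu) (fun nu => nu :\ [set t0])) => /= [|nu].
    apply: eq_bigl => nu; rewrite setU11 andbT; apply/andP/idP => [[nuA /eqP <-]|nuA].
      by have := partitionD1 nuA (setU11 _ _); rewrite setU1K.
    have t0nu : [set t0] \notin nu.
      by apply/negP=> /(notin_block nuA); rewrite inE eqxx.
    rewrite setU1K // eqxx; split=> //; apply: partitionU1 => //.
      by apply/set0Pn; exists t0; rewrite inE.
    by rewrite disjoints1.
  by case/andP=> _; apply: setD1K.
rewrite pair_big_dep /= (reindex_onto insert_block remove_point) => /= [|nu /andP[]]; last first.
  exact: remove_pointK.
apply: eq_bigl => -[nu B] /=; apply/idP/idP => [|/andP[]]; last first.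
  by move=> nuA /(insert_blockP nuA) /and3P[-> -> ->].
case/andP=> /andP[nuA nu0] /eqP e.
have := remove_pointP nuA nu0; rewrite e /= => ->.
(* The shortened block belongs to the shortened partition by construction; through [e] this says
   that [B] is in [nu]. *)
have := setU11 (remove_point (insert_block (nu, B))).2
  (insert_block (nu, B) :\ pblock (insert_block (nu, B)) t0).
by rewrite -[_ |: _]/(remove_point _).1 e.
Qed.
End PartitionInsert.

(** The factors below only look at elements larger than a given one, so adding a new minimum leaves
    the earlier factors untouched. *)
Lemma set_min_ind b (P : {set 'I_b} -> Prop) :
  P set0 ->
  (forall (t : 'I_b) (A : {set 'I_b}),
     (forall s : 'I_b, s \in A -> (t < s)%N) -> P A -> P (t |: A)) ->
  forall A, P A.
Proof.
move=> P0 PU A; have [n] := ubnP #|A|; elim: n A => // n IHn A ltAn.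
have [->//|/set0Pn[t1 At1]] := eqVneq A set0.
case: (arg_minnP (fun t : 'I_b => t : nat) At1) => t tA minA; have {tA}At : t \in A := tA.
rewrite -(setD1K At); apply: PU => [s|].
  by rewrite !inE => /andP[st As]; rewrite ltn_neqAle eq_sym st minA.
by apply: IHn; move: ltAn; rewrite (cardsD1 t A) At.
Qed.

(** * Tail products and sums over maps *)

Section TailProduct.

Variables (R : comNzRingType) (b : nat) (w : 'I_b -> R).
Implicit Types (A : {set 'I_b}) (Q : rel 'I_b) (N : R).

(** Two choices of [Q] matter: the full relation, which gives the formula for S(T), and equality of
    the values of a map f, which gives the product of such formulas over the fibres of f
    ([prod_tail_prod_fibres]). *)
Definition tail_prod N Q A : R :=
  \prod_(t in A) (N - \sum_(s in A | (t < s)%N && Q t s) w s).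

Lemma tail_prodU1 N Q (t0 : 'I_b) A : (forall s : 'I_b, s \in A -> (t0 < s)%N) ->
  tail_prod N Q (t0 |: A) = (N - \sum_(s in A | Q t0 s) w s) * tail_prod N Q A.
Proof.
move=> ltA; have t0A : t0 \notin A by apply/negP=> /ltA; rewrite ltnn.
rewrite /tail_prod big_setU1 //=; congr ((_ - _) * _).
  apply: eq_bigl => s; rewrite !inE; case: eqVneq => [->|_] /=.
    by rewrite ltnn (negPf t0A).
  by case As: (s \in A); rewrite //= ltA.
apply: eq_bigr => t At; congr (_ - _); apply: eq_bigl => s.
by rewrite !inE; case: eqVneq => [->|_] //=; rewrite ltnNge ltnW ?ltA // (negPf t0A).
Qed.

Lemma tail_prod1 N Q t : tail_prod N Q [set t] = N.
Proof.
by rewrite /tail_prod big_set1 big1 ?subr0 // => s /andP[/set1P->]; rewrite ltnn.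
Qed.

(* A map A -> J is encoded by the map 'I_b -> J that takes the value j0 off A. *)
Variables (J : finType) (j0 : J).

Lemma sum_supportU1 (V : nmodType) (t0 : 'I_b) A (Z : {ffun 'I_b -> J} -> V) : t0 \notin A ->
  \sum_(f : {ffun 'I_b -> J} | j0.-support f \subset t0 |: A) Z f =
  \sum_(f : {ffun 'I_b -> J} | j0.-support f \subset A)
    \sum_j Z [ffun t => if t == t0 then j else f t].
Proof.
move=> t0A; rewrite pair_big_dep /=.
rewrite (reindex_onto
  (fun x : {ffun 'I_b -> J} * J => [ffun t => if t == t0 then x.2 else x.1 t])
  (fun f : {ffun 'I_b -> J} => ([ffun t => if t == t0 then j0 else f t], f t0))) /=.
  apply: eq_bigl => -[f j] /=; apply/andP/andP => [[/supportP sf /eqP[ef _]]|[/supportP sf _]].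
    split=> //; apply/supportP=> t tA; rewrite -ef ffunE; case: eqVneq => // tt0.
    by apply: sf; rewrite !inE negb_or tt0.
  split.
    apply/supportP=> t; rewrite !inE negb_or ffunE => /andP[/negPf-> tA].
    exact: sf.
  apply/eqP; congr (_, _); last by rewrite ffunE eqxx.
  by apply/ffunP=> t; rewrite !ffunE; case: eqVneq => // ->; rewrite sf.
by move=> f _; apply/ffunP=> t; rewrite !ffunE; case: eqVneq => // ->.
Qed.

(** For a fixed map on the larger points, the value j at the minimum t0 gives the factor N - \sum_(f
    s = j) w s. Each s is counted for exactly one j, so the sum over j is N|J| - \sum_s w s, the
    factor of t0 on the right. *)
Lemma sum_tail_prod N A :
  \sum_(f : {ffun 'I_b -> J} | j0.-support f \subset A)
     tail_prod N [rel t s | f s == f t] A =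
  tail_prod (N *+ #|J|) (fun _ _ => true) A.
Proof.
elim/set_min_ind: A => [|t0 A ltA IHA].
  rewrite /tail_prod big_set0 (big_pred1 [ffun=> j0]) ?big_set0 // => f.
  apply/supportP/eqP=> [sf|->] => [|t _]; last by rewrite ffunE.
  by apply/ffunP=> t; rewrite ffunE sf ?inE.
have t0A : t0 \notin A by apply/negP=> /ltA; rewrite ltnn.
have neqA s : s \in A -> (s == t0) = false.
  by move=> As; apply: contraNF t0A => /eqP <-.
rewrite sum_supportU1 // tail_prodU1 // -IHA big_distrr /=; apply: eq_bigr => f _.
rewrite (eq_bigr (fun j => (N - \sum_(s in A | f s == j) w s) *
                           tail_prod N [rel t s | f s == f t] A)) => [|j _].
  rewrite -big_distrl /= sumrB sumr_const; congr ((_ - _) * _).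
  by under [RHS]eq_bigl do rewrite andbT; rewrite (partition_big f predT).
rewrite tail_prodU1 //; congr ((_ - _) * _).
  by apply: eq_bigl => s; rewrite /= !ffunE eqxx; case As: (s \in A); rewrite //= neqA.
apply: eq_bigr => t At; congr (_ - _); apply: eq_bigl => s.
rewrite /= !ffunE (neqA t) //.
by case As: (s \in A); rewrite //= neqA.
Qed.

End TailProduct.

Section MvalTheory.

Variables (p b : nat) (l : 'I_b -> nat).

Lemma Mval1 t : Mval p l [set t] = 1%N.
Proof.
apply: big1 => s /andP[/set1P-> /exists_inP[r /set1P->]].
by rewrite ltnn.
Qed.

(** Below the new minimum, the old least element of [A] is no longer exempt; its factor is the sum
    over all of [A]. *)
Lemma MvalU1 (t0 : 'I_b) (A : {set 'I_b}) : A != set0 -> (forall s : 'I_b, s \in A -> (t0 < s)%N) ->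
  Mval p l (t0 |: A) = (Mval p l A * \sum_(s in A) p ^ l s)%N.
Proof.
case/set0Pn=> t1 At1 ltA; have t0A : t0 \notin A by apply/negP=> /ltA; rewrite ltnn.
case: (arg_minnP (fun t : 'I_b => t : nat) At1) => t tA minA; have {tA}At : t \in A := tA.
transitivity (\prod_(t in A) \sum_(s in A | (t <= s)%N) p ^ l s)%N.
  rewrite /Mval big_mkcondr big_setU1 //= ifN ?mul1n.
    apply: eq_bigr => r Ar; rewrite ifT; last first.
      by apply/exists_inP; exists t0; rewrite ?setU11 ?ltA.
    apply: eq_bigl => s; rewrite !inE; case: eqVneq => [->|_] //=.
    by rewrite leqNgt ltA // (negPf t0A).
  apply/exists_inP=> -[s]; rewrite !inE => /predU1P[->|/ltA lts]; first by rewrite ltnn.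
  by rewrite ltnNge ltnW.
rewrite (bigD1 t) //= mulnC /Mval; congr (_ * _)%N.
  apply: eq_bigl => r; case Ar: (r \in A) => //=; apply/idP/exists_inP => [rt|[s As sr]].
    by exists t => //; rewrite ltn_neqAle minA // andbT eq_sym.
  by apply: contraTneq sr => ->; rewrite -leqNgt minA.
by apply: eq_bigl => s; case As: (s \in A); rewrite //= minA.
Qed.

End MvalTheory.

Section TailProductFibres.

Variables (R : comNzRingType) (b : nat) (w : 'I_b -> R) (J : finType).
Implicit Types (f : {ffun 'I_b -> J}) (A : {set 'I_b}).

Lemma prod_fibres f A (F : 'I_b -> R) :
  \prod_j \prod_(t in [set t in A | f t == j]) F t = \prod_(t in A) F t.
Proof.
rewrite [RHS](partition_big f predT) //=; apply: eq_bigr => j _.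
by apply: eq_bigl => t; rewrite inE.
Qed.

Lemma prod_tail_prod_fibres f A N :
  \prod_j tail_prod w N (fun _ _ => true) [set t in A | f t == j] =
  tail_prod w N [rel t s | f s == f t] A.
Proof.
rewrite -[RHS](prod_fibres f); apply: eq_bigr => j _; apply: eq_bigr => t.
rewrite inE => /andP[_ /eqP ft]; congr (_ - _); apply: eq_bigl => s /=.
by rewrite inE ft andbT -andbA [(_ < _)%N && _]andbC.
Qed.

End TailProductFibres.

(** * From tail products to sums over set partitions *)

Section PartitionSum.

Variables (R : comNzRingType) (p b : nat) (l : 'I_b -> nat) (N : R).
Variables (J : finType) (j0 : J).
Implicit Types (f : {ffun 'I_b -> J}) (A B : {set 'I_b}) (nu : {set {set 'I_b}}).

Definition constant_on f B := [forall s in B, forall t in B, f s == f t].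

Lemma constant_onP f B :
  reflect {in B &, forall s t, f s = f t} (constant_on f B).
Proof.
apply: (iffP forall_inP) => [fB s t Bs Bt | fB s Bs].
  exact/eqP/(forall_inP (fB s Bs)).
by apply/forall_inP=> t Bt; rewrite (fB s t).
Qed.

(* The indicator restricts the sums over partitions below to those on whose   *)
(* blocks f is constant.                                                      *)
Definition block_weight f B : R :=
  (constant_on f B)%:R * ((-1) ^+ #|B|.-1 * N * (Mval p l B)%:R).

(** One more point flips the sign and multiplies M by the sum over [B]. If f is constant on [B], the
    restricted sum is either this whole sum or 0, the latter exactly when the enlarged block loses
    constancy. *)
Lemma block_weightU1 f (t0 : 'I_b) B :
  B != set0 -> (forall s : 'I_b, s \in B -> (t0 < s)%N) ->
  block_weight f (t0 |: B) =
  - (\sum_(s in B | f s == f t0) (p ^ l s)%:R) * block_weight f B.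
Proof.
move=> B0 ltB; have t0B : t0 \notin B by apply/negP=> /ltB; rewrite ltnn.
have [r Br] := set0Pn _ B0.
rewrite /block_weight MvalU1 //; case: (constant_onP f B) => [fB|nfB]; last first.
  rewrite mul0r mulr0; case: constant_onP => [fB'|]; rewrite ?mul0r //.
  by case: nfB => s t Bs Bt; apply: fB'; rewrite !inE (Bs, Bt) orbT.
have [fr|fr] := eqVneq (f r) (f t0); last first.
  rewrite [X in - X * _]big1 ?oppr0 ?mul0r => [|s /andP[Bs]]; last first.
    by rewrite (fB s r) // (negPf fr).
  case: constant_onP => [fB'|]; rewrite ?mul0r //.
  by case/eqP: fr; apply: fB'; rewrite !inE ?eqxx ?Br ?orbT.
have -> : constant_on f (t0 |: B).
  have ft s : s \in t0 |: B -> f s = f t0.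
    by rewrite !inE => /predU1P[->//|Bs]; rewrite (fB s r).
  by apply/constant_onP=> s t /ft-> /ft->.
have -> : \sum_(s in B | f s == f t0) (p ^ l s)%:R = (\sum_(s in B) p ^ l s)%:R :> R.
  rewrite natr_sum; apply: eq_bigl => s.
  by case Bs: (s \in B); rewrite //= (fB s r) // fr eqxx.
rewrite cardsU1 t0B /= (cardsD1 r B) Br !add1n /= exprS natrM !mul1r.
by ring.
Qed.

(** The minimum t0 is either alone, contributing N, or joins a block B, contributing minus the sum
    of the p^(l_s) over the s in B with f s = f t0. Over all blocks these add up to the factor of t0
    in the tail product. *)
Lemma sum_partition_block_weight f A :
  \sum_(nu | partition nu A) \prod_(B in nu) block_weight f B =
  tail_prod (fun s => (p ^ l s)%:R) N [rel t s | f s == f t] A.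
Proof.
elim/set_min_ind: A => [|t0 A ltA IHA].
  rewrite /tail_prod big_set0 (big_pred1 set0) ?big_set0 // => nu.
  by rewrite partition_set0.
have t0A : t0 \notin A by apply/negP=> /ltA; rewrite ltnn.
rewrite sum_partitionU1 // tail_prodU1 // -IHA mulr_sumr.
apply: eq_bigr => nu nuA; rewrite mulrDl mulNr; congr (_ + _).
  rewrite big_setU1 /=; last first.
    by apply: contra t0A => /(partitionS nuA); rewrite sub1set.
  congr (_ * _); rewrite /block_weight Mval1 cards1 /= expr0 mul1r mulr1.
  have -> : constant_on f [set t0] by apply/constant_onP=> s t /set1P-> /set1P->.
  by rewrite mul1r.
rewrite (set_partition_big_cond _ nuA) /= mulr_suml -sumrN.
apply: eq_bigr => B Bnu.
have ltB (s : 'I_b) : s \in B -> (t0 < s)%N.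
  by move/(subsetP (partitionS nuA Bnu)); apply: ltA.
rewrite big_setU1 /=; last first.
  rewrite inE negb_and; apply/orP; right.
  by apply: contra t0A => /(partitionS nuA)/subsetP-> //; rewrite setU11.
rewrite block_weightU1 ?(partition_neq0 nuA) // -mulNr -mulrA; congr (_ * _).
by rewrite [RHS](big_setD1 B).
Qed.

Variable c : 'I_b -> J -> R.

(** Expanding the product chooses one j per block, which is the same as a map on points that is
    constant on blocks. Choice functions take the value [j0] off [nu]. *)
Lemma prod_partition_sum nu : partition nu [set: 'I_b] ->
  \prod_(B in nu) \sum_j \prod_(t in B) c t j =
  \sum_f \prod_(B in nu) (constant_on f B)%:R * \prod_t c t (f t).
Proof.
move=> nuT; have tI := partition_trivIset nuT.
have cov t : t \in cover nu by rewrite (cover_partition nuT) inE.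
rewrite (big_distr_big_dep j0) /=.
transitivity (\sum_(f | [forall B in nu, constant_on f B]) \prod_t c t (f t)).
  rewrite (reindex_onto (fun g : {ffun {set 'I_b} -> J} => [ffun t : 'I_b => g (pblock nu t)])
    (fun f => [ffun B : {set 'I_b} =>
       if [pick t | (t \in B) && (B \in nu)] is Some t then f t else j0])).
    apply: eq_big => /= [g|g _]; last first.
      rewrite (eq_bigl (fun t => t \in [set: 'I_b])) => [|t]; last by rewrite inE.
      rewrite (set_partition_big _ nuT); apply: eq_bigr => B Bnu; apply: eq_bigr => t Bt.
      by rewrite ffunE (def_pblock tI Bnu Bt).
    apply/pfamilyP/andP => [[/supportP sg _]|[_ /eqP <-]].
      split.
        apply/forall_inP=> B Bnu; apply/constant_onP=> s t Bs Bt.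
        by rewrite !ffunE (def_pblock tI Bnu Bs) (def_pblock tI Bnu Bt).
      apply/eqP/ffunP=> B; rewrite !ffunE; case: pickP => [t /andP[Bt Bnu]|noB].
        by rewrite ffunE (def_pblock tI Bnu Bt).
      have [Bnu|/sg-> //] := boolP (B \in nu).
      have [t Bt] := set0Pn _ (partition_neq0 nuT Bnu).
      by have:= noB t; rewrite Bt Bnu.
    split=> //; apply/supportP=> B nuB; rewrite ffunE.
    by case: pickP => // t; rewrite (negPf nuB) andbF.
  move=> f /forall_inP fc; apply/ffunP=> t; rewrite !ffunE.
  have Pnu := pblock_mem (cov t); have Pt := etrans (mem_pblock nu t) (cov t).
  case: pickP => [s /andP[Ps _]|/(_ t)]; last by rewrite Pt Pnu.
  exact: (constant_onP _ _ (fc _ Pnu)).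
rewrite big_mkcond; apply: eq_bigr => f _; case: ifPn => [/forall_inP fc|].
  by rewrite [X in _ = X * _]big1 ?mul1r // => B /fc->.
case/forall_inPn=> B Bnu /negPf fB; rewrite [X in X * _](bigD1 B) //= fB.
by rewrite !mul0r.
Qed.

Lemma sum_partition_tail_prod :
  \sum_(nu | partition nu [set: 'I_b])
    (-1) ^+ (b - #|nu|) * N ^+ #|nu| *
    \prod_(B in nu) ((Mval p l B)%:R * \sum_j \prod_(t in B) c t j) =
  \sum_(f : {ffun 'I_b -> J}) (\prod_t c t (f t)) *
    tail_prod (fun s => (p ^ l s)%:R) N [rel t s | f s == f t] [set: 'I_b].
Proof.
under [RHS]eq_bigr do rewrite -sum_partition_block_weight mulr_sumr.
rewrite exchange_big /=; apply: eq_bigr => nu nuT.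
(* The block sizes add up to b, so the exponents |B| - 1 add up to b - |nu|. *)
have sgn : \prod_(B in nu) (-1) ^+ #|B|.-1 = (-1) ^+ (b - #|nu|) :> R.
  have eb := card_partition nuT; rewrite cardsT card_ord in eb.
  rewrite [X in (X - _)%N]eb -sum1_card -sumnB => [|B Bnu]; last first.
    by rewrite card_gt0 (partition_neq0 nuT).
  by rewrite prodrXr; congr (_ ^+ _); apply: eq_bigr => B _; rewrite subn1.
rewrite big_split /= prod_partition_sum // !mulr_sumr; apply: eq_bigr => f _.
rewrite /block_weight !big_split /= prodr_const sgn.
move: (\prod_(t < b) _) (\prod_(B in nu) (constant_on f B)%:R).
move: (\prod_(B in nu) (Mval p l B)%:R) (_ * _) => M S C K.
by ring.
Qed.

End PartitionSum.

(** * Cycle types *)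

Section CycleType.

Variable n : nat.
Implicit Types (s : 'S_n) (x y : 'I_n) (m : nat).

Definition ncycles s m := #|[set X in porbits s | #|X| == m]|.

Lemma card_points_in_cycles s m : #|[set x | #|porbit s x| == m]| = (m * ncycles s m)%N.
Proof.
rewrite -sum1dep_card mulnC.
rewrite (partition_big (porbit s) (mem [set X in porbits s | #|X| == m])) => [|x mx] /=.
  rewrite -sum_nat_const; apply: eq_bigr => _ /setIdP[/imsetP[x _ ->] /eqP <-].
  rewrite -[RHS]sum1_card; apply: eq_bigl => y.
  by rewrite eq_porbit_mem andb_idl // -eq_porbit_mem => /eqP->.
by rewrite inE imset_f.
Qed.

Lemma count_card_porbits s m :
  count_mem m [seq #|X| | X : {set 'I_n} <- enum (porbits s)] = ncycles s m.
Proof.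
rewrite /ncycles count_map -sum1_count big_enum_cond /= -[RHS]sum1_card.
by apply: eq_bigl => X; rewrite inE.
Qed.

Lemma count_cycle_lengths s m : (1 < m)%N -> count_mem m (cycle_lengths s) = ncycles s m.
Proof.
move=> m1; rewrite -count_card_porbits !count_map count_filter.
by apply: eq_count => X /=; case: eqP => //= ->.
Qed.

Lemma ncycles0 s : ncycles s 0 = 0%N.
Proof.
apply: eq_card0 => X; rewrite !inE; apply/andP=> -[/imsetP[x _ ->]].
by rewrite (negPf (card_porbit_neq0 s x)).
Qed.

Lemma card_porbit_gt1 s x : (1 < #|porbit s x|)%N = (s x != x).
Proof.
apply/idP/idP => [|sx].
  apply: contraTneq => sx; rewrite -leqNgt -(cards1 x); apply: subset_leq_card.
  apply/subsetP=> y /porbitP[i ->]; rewrite inE permX.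
  by elim: i => //= i /eqP->; rewrite sx.
rewrite ltn_neqAle lt0n card_porbit_neq0 andbT; apply: contraNneq sx => e.
by have /= := iter_porbit s x; rewrite -e /= => ->.
Qed.

Lemma sumn_cycle_lengths s : sumn (cycle_lengths s) = #|[set x | s x != x]|.
Proof.
rewrite sumnE big_map big_filter big_enum_cond /= -sum1dep_card.
rewrite [RHS](partition_big (porbit s) (mem [set X in porbits s | (1 < #|X|)%N])) => [|x sx] /=.
  apply: eq_big => [X|X]; first by rewrite inE.
  case/andP=> /imsetP[x _ ->] x1.
  rewrite -sum1_card; apply: eq_bigl => y.
  rewrite eq_porbit_mem andb_idl // -eq_porbit_mem => /eqP exy.
  by rewrite -card_porbit_gt1 exy.
by rewrite inE imset_f //= card_porbit_gt1.
Qed.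

(** Only fixed points are missing from [cycle_lengths]; their number is n minus the sum of the
    listed lengths. *)
Lemma eq_ncycles s s' : perm_eq (cycle_lengths s) (cycle_lengths s') ->
  ncycles s =1 ncycles s'.
Proof.
move=> ss' [|[|m]]; first by rewrite !ncycles0.
  have fixE (t : 'S_n) : [set x | #|porbit t x| == 1%N] = ~: [set x | t x != x].
    apply/setP=> x; rewrite in_setC !in_set. rewrite -card_porbit_gt1.
    by rewrite -leqNgt eqn_leq lt0n card_porbit_neq0 andbT.
  rewrite -[LHS]mul1n -[RHS]mul1n -!card_points_in_cycles !fixE.
  rewrite [LHS]cardsCs [RHS]cardsCs !setCK.
  by rewrite -!sumn_cycle_lengths (perm_sumn ss').
by rewrite -!count_cycle_lengths //; apply/seq.permP.
Qed.

Lemma eq_permX_mod s x i j :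
  ((s ^+ i)%g x == (s ^+ j)%g x) = (i == j %[mod #|porbit s x|]).
Proof.
set d := #|_|; have d0 : (0 < d)%N by rewrite lt0n card_porbit_neq0.
have modE k : (s ^+ k)%g x = nth x (traject s x d) (k %% d).
  rewrite nth_traject ?ltn_mod // permX {1}(divn_eq k d) addnC iterD; congr iter.
  by elim: (k %/ d)%N => //= c IHc; rewrite mulSn iterD IHc iter_porbit.
by rewrite !modE nth_uniq ?uniq_traject_porbit ?size_traject ?ltn_mod.
Qed.

(* A length-preserving bijection beta from the cycles of s to those of s',    *)
(* together with base points r and r', yields the conjugating permutation     *)
(* s^i(r) |-> s'^i(r').                                                       *)
Lemma eq_ncycles_conj s s' : ncycles s =1 ncycles s' -> exists z : 'S_n, s' = (s ^ z)%g.
Proof.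
move=> ess'; have : perm_eq [seq #|X| | X : {set 'I_n} <- enum (porbits s)]
                           [seq #|X| | X : {set 'I_n} <- enum (porbits s')].
  by apply/allP=> m _ /=; rewrite !count_card_porbits ess'.
case/(perm_iotaP 0%N) => Is permIs eIs; rewrite size_map in permIs.
have szIs : size Is = size (enum (porbits s)).
  by have /(congr1 size) := eIs; rewrite !size_map.
(* [Is] permutes the positions so that the two lists of cycle lengths agree; [beta] follows it from
   cycle to cycle. *)
pose beta X := nth set0 (enum (porbits s')) (nth 0%N Is (index X (enum (porbits s)))).
have ltIs X : X \in porbits s ->
    (nth 0%N Is (index X (enum (porbits s))) < size (enum (porbits s')))%N.
  move=> sX; have : nth 0%N Is (index X (enum (porbits s))) \in Is.
    by rewrite mem_nth // szIs index_mem mem_enum.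
  by rewrite (perm_mem permIs) mem_iota.
have beta_porbits X : X \in porbits s -> beta X \in porbits s'.
  by move=> sX; rewrite -mem_enum mem_nth ?ltIs.
have card_beta X : X \in porbits s -> #|beta X| = #|X|.
  move=> sX; have := congr1 (nth 0%N ^~ (index X (enum (porbits s)))) eIs.
  rewrite (nth_map set0) ?index_mem ?mem_enum // nth_index ?mem_enum // => ->.
  by rewrite (nth_map 0%N) ?szIs ?index_mem ?mem_enum // (nth_map set0) ?ltIs.
have beta_inj : {in porbits s &, injective beta}.
  move=> X Y sX sY /eqP; rewrite nth_uniq ?ltIs ?enum_uniq //.
  rewrite nth_uniq ?szIs ?index_mem ?mem_enum //; last first.
    by rewrite (perm_uniq permIs) iota_uniq.
  move/eqP=> eXY; rewrite -[X](nth_index set0 (s := enum (porbits s))) ?mem_enum //.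
  by rewrite eXY nth_index ?mem_enum.
have sx x : porbit s x \in porbits s by apply: imset_f.
(* The picked points depend only on the cycle of [x], as the picks never fail and the default [x] is
   not reached. *)
pose r x := odflt x [pick y in porbit s x].
pose r' x := odflt x [pick y in beta (porbit s x)].
have rP x : r x \in porbit s x.
  by rewrite /r; case: pickP => // /(_ x); rewrite porbit_id.
have r'P x : r' x \in beta (porbit s x).
  rewrite /r'; case: pickP => // b0.
  have := card_beta _ (sx x); rewrite (eq_card0 b0) => /esym/eqP.
  by rewrite (negPf (card_porbit_neq0 s x)).
have porbit_r x : porbit s (r x) = porbit s x by apply/eqP; rewrite eq_porbit_mem.
have porbit_r' x : porbit s' (r' x) = beta (porbit s x).
  have /imsetP[y _ ey] := beta_porbits _ (sx x); apply/eqP.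
  by rewrite ey eq_porbit_mem -ey.
have eq_r x y : porbit s x = porbit s y -> r x = r y /\ r' x = r' y.
  move=> exy; rewrite /r /r' exy; split; case: pickP => // b0.
    by have := b0 y; rewrite porbit_id.
  by have := r'P y; rewrite /r' b0.
have card_r x : #|porbit s' (r' x)| = #|porbit s (r x)|.
  by rewrite porbit_r' card_beta // porbit_r.
have eP x : exists i, (s ^+ i)%g (r x) == x.
  have /porbitP[i e] : x \in porbit s (r x) by rewrite porbit_sym rP.
  by exists i; apply/eqP.
pose e x := xchoose (eP x); have eK x : (s ^+ e x)%g (r x) = x := eqP (xchooseP (eP x)).
pose f x := (s' ^+ e x)%g (r' x).
have f_inj : injective f.
  move=> x y efxy; have exy : porbit s x = porbit s y.
    have inj_xy := beta_inj _ _ (sx x) (sx y); apply: inj_xy.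
    rewrite -!porbit_r' -(porbit_perm s' (e x)).
    by rewrite -[in RHS](porbit_perm s' (e y)) -/(f x) efxy.
  have [erxy er'xy] := eq_r _ _ exy; move/eqP: efxy.
  rewrite /f -er'xy eq_permX_mod card_r -eq_permX_mod => /eqP.
  by rewrite eK erxy eK.
have fS x : f (s x) = s' (f x).
  have esx : porbit s (s x) = porbit s x by rewrite -[s]expg1 porbit_perm.
  have [ers er's] := eq_r _ _ esx; apply/eqP.
  rewrite /f er's -permM -expgSr eq_permX_mod card_r -eq_permX_mod.
  by rewrite -{1}ers eK expgSr permM eK.
exists (perm f_inj); apply: (mulgI (perm f_inj)); rewrite -conjgC.
by apply/permP=> x; rewrite !permM !permE fS.
Qed.

Lemma conj_eq_ncycles s (z : 'S_n) : ncycles (s ^ z)%g =1 ncycles s.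
Proof.
case=> [|m]; first by rewrite !ncycles0.
apply/eqP; rewrite -(eqn_pmul2l (ltn0Sn m)) -!card_points_in_cycles.
rewrite -[X in _ == X](card_imset _ (@perm_inj _ z)); apply/eqP/eq_card => y.
rewrite inE -[y](permKV z); move: (z^-1%g y) => {}y; rewrite mem_imset ?inE; last exact: perm_inj.
congr (_ == _); rewrite -[RHS](card_imset _ (@perm_inj _ z)); apply: eq_card => v.
apply/porbitP/imsetP => [[i ->]|[_ /porbitP[i ->] ->]].
  by exists ((s ^+ i)%g y); rewrite ?mem_porbit // -conjXg permJ.
by exists i; rewrite -conjXg permJ.
Qed.

Variables (I : finType) (w : I -> nat).
Hypothesis w_gt1 : forall t, (1 < w t)%N.
Implicit Types T : {set I}.

(** Types are indexed by sets of indices rather than by lists of lengths, so that a type can be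
    split along the fibres of a map on indices. *)
Definition has_cycle_type s T := perm_eq (cycle_lengths s) [seq w t | t in T].

Lemma has_cycle_typeP s T :
  reflect (forall m, (1 < m)%N -> ncycles s m = (\sum_(t in T) (w t == m))%N)
          (has_cycle_type s T).
Proof.
have countE m : count_mem m [seq w t | t in T] = (\sum_(t in T) (w t == m))%N.
  rewrite count_map -sum1_count big_enum_cond big_mkcondr.
  by apply: eq_bigr => t _ /=; case: eqP.
apply: (iffP idP) => [/seq.permP sT m m1|sT].
  by rewrite -count_cycle_lengths // sT countE.
apply/allP=> m; rewrite mem_cat /= countE => mL.
suffices m1 : (1 < m)%N by rewrite count_cycle_lengths // sT.
case/orP: mL => [/mapP[X]|/imageP[t _ ->] //].
by rewrite mem_filter => /andP[X1 _ ->].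
Qed.

Lemma sum_has_cycle_type s T : has_cycle_type s T ->
  (\sum_(t in T) w t)%N = #|[set x | s x != x]|.
Proof.
by move/perm_sumn; rewrite sumn_cycle_lengths => ->; rewrite sumnE big_map big_enum.
Qed.

Lemma has_cycle_type_conj s s' T : has_cycle_type s T ->
  has_cycle_type s' T = (s' \in s ^: [set: 'S_n])%g.
Proof.
move=> sT; apply/idP/imsetP => [s'T|[x _ ->]].
  have [|x ->] := @eq_ncycles_conj s s'; last by exists x; rewrite ?inE.
  by apply: eq_ncycles; rewrite (perm_trans sT) // perm_sym.
apply/has_cycle_typeP=> m m1; rewrite conj_eq_ncycles.
exact: (has_cycle_typeP _ _ sT).
Qed.

Lemma has_cycle_type0 s : has_cycle_type s set0 = (s == 1%g).
Proof.
apply/idP/eqP => [/sum_has_cycle_type|->].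
  rewrite big_set0 => /esym/eqP; rewrite cards_eq0 => /eqP s0.
  apply/permP=> x; rewrite perm1; apply/eqP; apply/negPn/negP => sx.
  by have := in_set0 x; rewrite -s0 inE sx.
have c0 : sumn (cycle_lengths (1%g : 'S_n)) = 0%N.
  rewrite sumn_cycle_lengths; apply: eq_card0 => x.
  by rewrite !inE perm1 eqxx.
rewrite /has_cycle_type /image_mem enum_set0 /=; move: c0; rewrite /cycle_lengths.
case E: (filter _ _) => [|X E'] //=; have : X \in X :: E' by rewrite mem_head.
by rewrite -E mem_filter => /andP[X1 _]; case: #|X| X1.
Qed.

Definition full_cycle s := [forall x, forall y, y \in porbit s x].

Lemma full_cycleP s : reflect (forall x y, y \in porbit s x) (full_cycle s).
Proof.
apply: (iffP forallP) => [fs x|fs x]; first by apply/forallP; apply: fs.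
by apply/forallP=> y; apply: fs.
Qed.

Lemma has_cycle_type1 s t : w t = n -> has_cycle_type s [set t] = full_cycle s.
Proof.
move=> wt; have n1 : (1 < n)%N by rewrite -wt.
apply/has_cycle_typeP/full_cycleP => [sT x y|fs m m1].
  have [nn] : ncycles s n = 1%N by rewrite sT // big_set1 wt eqxx.
  have := card_points_in_cycles s n; rewrite nn muln1 => cn.
  have /eqP px : [set x | #|porbit s x| == n] == setT.
    by rewrite eqEcard subsetT cardsT card_ord cn leqnn.
  have : x \in [set x | #|porbit s x| == n] by rewrite px inE.
  rewrite inE => /eqP cx; have /eqP-> : porbit s x == setT; last by rewrite inE.
  by rewrite eqEcard subsetT cardsT card_ord cx leqnn.
rewrite big_set1 wt; apply/eqP; rewrite -(eqn_pmul2l (ltnW m1)) -card_points_in_cycles.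
have cx x : #|porbit s x| = n.
  by rewrite (_ : porbit s x = setT) ?cardsT ?card_ord //; apply/setP=> y; rewrite fs inE.
have [<-|nm] := eqVneq n m.
  rewrite muln1 -[X in _ == X]card_ord -cardsT; apply/eqP/eq_card => x.
  by rewrite !inE cx eqxx.
by rewrite muln0 cards_eq0; apply/eqP/setP=> x; rewrite !inE cx; apply/negbTE.
Qed.

End CycleType.

(** * Cycles in wreath products *)

Section WreathCycles.

Variables (q m N : nat) (eN : N = (q * m)%N).
Implicit Types (g : {ffun 'I_q -> 'S_m}) (h : 'S_q).

Lemma sum_block (V : nmodType) (F : 'I_N -> V) :
  \sum_y F y = \sum_i \sum_x F (block eN i x).
Proof.
rewrite pair_bigA /= (reindex (fun u : 'I_q * 'I_m => block eN u.1 u.2)) //.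
exists (fun y => (block_index eN y, block_offset eN y)) => [[i x] _|y _] /=.
  by rewrite block_indexK block_offsetK.
by rewrite blockK.
Qed.

Lemma block_inj i : injective (block eN i).
Proof. by move=> x y /(congr1 (block_offset eN)); rewrite !block_offsetK. Qed.

Lemma wr_permX g h j :
  (wr_perm eN g h ^+ j)%g =
  wr_perm eN [ffun i => \prod_(0 <= t < j) g ((h ^+ t)%g i)]%g (h ^+ j)%g.
Proof.
elim: j => [|j IHj].
  rewrite !expg0 -(wr_perm1 eN); congr wr_perm.
  by apply/ffunP=> i; rewrite !ffunE big_geq.
rewrite !expgSr IHj wr_permM; congr wr_perm.
by apply/ffunP=> i; rewrite !ffunE big_nat_recr.
Qed.

Lemma porbit_wr_perm1 g i x :
  porbit (wr_perm eN g 1) (block eN i x) = block eN i @: porbit (g i) x.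
Proof.
have wrX j : (wr_perm eN g 1 ^+ j)%g (block eN i x) = block eN i ((g i ^+ j)%g x).
  rewrite wr_permX wr_permE expg1n perm1 ffunE.
  suffices -> : (\prod_(0 <= t < j) g (((1 : 'S_q) ^+ t)%g i) = g i ^+ j)%g by [].
  elim: j => [|j IHj]; first by rewrite big_geq.
  by rewrite big_nat_recr //= IHj expg1n perm1 expgSr.
apply/setP=> y; apply/porbitP/imsetP => [[j ->]|[_ /porbitP[j ->] ->]].
  by exists ((g i ^+ j)%g x); rewrite ?mem_porbit ?wrX.
by exists j; rewrite wrX.
Qed.

Lemma ncycles_wr_perm1 g k : ncycles (wr_perm eN g 1) k = (\sum_i ncycles (g i) k)%N.
Proof.
case: k => [|k]; first by rewrite ncycles0 big1 // => i _; rewrite ncycles0.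
apply/eqP; rewrite -(eqn_pmul2l (ltn0Sn k)) -card_points_in_cycles big_distrr /=.
apply/eqP; under [RHS]eq_bigr do rewrite -card_points_in_cycles.
rewrite -sum1dep_card big_mkcond sum_block; apply: eq_bigr => i _.
rewrite -sum1dep_card [RHS]big_mkcond; apply: eq_bigr => x _.
by rewrite porbit_wr_perm1 card_imset //; apply: block_inj.
Qed.

Section CycleTypeTop1.

Variables (I : finType) (w : I -> nat).
Hypotheses (w_gt1 : forall t, (1 < w t)%N) (w_inj : injective w).
Implicit Types T : {set I}.

Let sum_eqw T t : (\sum_(s in T) (w s == w t))%N = (t \in T).
Proof.
rewrite big_mkcond (bigD1 t) //= eqxx big1 ?addn0 => [|s st]; first by case: ifP.
by rewrite (inj_eq w_inj) (negPf st) if_same.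
Qed.

(** With trivial top component, every cycle stays in one block. The lengths w t are distinct, so the
    block holding the cycle of length w t is determined, and at most one map f gives a nonzero
    term. *)
Lemma has_cycle_type_wr_perm1 (R : comNzSemiRingType) (i0 : 'I_q) g T :
  (has_cycle_type w (wr_perm eN g 1) T)%:R =
  \sum_(f : {ffun I -> 'I_q} | i0.-support f \subset T)
    \prod_i (has_cycle_type w (g i) [set t in T | f t == i])%:R :> R.
Proof.
have prodE (f : {ffun I -> 'I_q}) :
    \prod_i (has_cycle_type w (g i) [set t in T | f t == i])%:R =
    [forall i, has_cycle_type w (g i) [set t in T | f t == i]]%:R :> R.
  case: forallP => [fT|nfT]; first by rewrite big1 // => i _; rewrite fT.
  have /forallPn[i /negPf fi] : ~~ [forall i, has_cycle_type w (g i) [set t in T | f t == i]].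
    by apply/forallP.
  by rewrite (bigD1 i) //= fi mul0r.
under eq_bigr do rewrite prodE.
have sumE (f : {ffun I -> 'I_q}) k :
    (\sum_i \sum_(t in [set t in T | f t == i]) (w t == k) = \sum_(t in T) (w t == k))%N.
  rewrite [RHS](partition_big f predT) //=; apply: eq_bigr => i _.
  by apply: eq_bigl => t; rewrite inE.
case: (has_cycle_typeP w_gt1) => [gT|ngT]; last first.
  rewrite big1 // => f _; case: forallP => // fT; case: ngT => k k1.
  rewrite ncycles_wr_perm1 -(sumE f); apply: eq_bigr => i _.
  exact: (has_cycle_typeP w_gt1 _ _ (fT i)).
have sumg t : t \in T -> (\sum_i ncycles (g i) (w t) = 1)%N.
  by move=> Tt; rewrite -ncycles_wr_perm1 gT // sum_eqw Tt.
(* [f0] sends t to the block that contains the cycle of length w t, and takes the default [i0] off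
   [T]. *)
pose f0 : {ffun I -> 'I_q} := [ffun t =>
  if t \in T then odflt i0 [pick i | 0 < ncycles (g i) (w t)]%N else i0].
have f0P t i : t \in T -> ncycles (g i) (w t) = (f0 t == i).
  move=> Tt; have := sumg t Tt; rewrite ffunE Tt.
  case: pickP => /= [j gj|g0]; last by rewrite big1 // => j _; have := g0 j; case: (ncycles _ _).
  rewrite (bigD1 j) //=; move: gj; case Ej: (ncycles _ _) => [|[|c]] // _.
  case=> /eqP; rewrite sum_nat_eq0 => /forall_inP g0.
  case: eqVneq => [<-//|ji]; apply/eqP/g0.
  by rewrite eq_sym.
rewrite (bigD1 f0) /=; last first.
  by apply/supportP=> t /negPf tT; rewrite ffunE tT.
have -> : [forall i, has_cycle_type w (g i) [set t in T | f0 t == i]].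
  apply/forallP=> i; apply/has_cycle_typeP => // k k1.
  have [/exists_inP[t Tt /eqP <-]|noT] := boolP [exists t in T, w t == k].
    by rewrite f0P // sum_eqw inE Tt.
  have nk t : t \in T -> (w t == k) = false.
    by move=> Tt; apply: contraNF noT => tk; apply/exists_inP; exists t.
  rewrite big1 => [|t /setIdP[Tt _]]; last by rewrite nk.
  have := gT _ k1; rewrite ncycles_wr_perm1 [RHS]big1 => [/eqP|t Tt]; last by rewrite nk.
  by rewrite sum_nat_eq0 => /forallP/(_ i)/eqP.
rewrite big1 ?addr0 // => f /andP[/supportP sf neqf].
case: forallP => // fT; case/eqP: neqf; apply/ffunP=> t.
have [Tt|tT] := boolP (t \in T); last by rewrite sf // ffunE (negPf tT).
have := has_cycle_typeP w_gt1 _ _ (fT (f t)) _ (w_gt1 t).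
by rewrite sum_eqw f0P // inE Tt eqxx; case: eqVneq.
Qed.

Lemma sum_wr_perm1 (R : comNzSemiRingType) (i0 : 'I_q) (G : {set 'S_m})
    (phi : 'I_q -> 'S_m -> R) T :
  \sum_(g : {ffun 'I_q -> 'S_m} |
      (g \in ffun_on (mem G)) && has_cycle_type w (wr_perm eN g 1) T)
    \prod_i phi i (g i) =
  \sum_(f : {ffun I -> 'I_q} | i0.-support f \subset T)
    \prod_i \sum_(s in G | has_cycle_type w s [set t in T | f t == i]) phi i s.
Proof.
transitivity (\sum_(f : {ffun I -> 'I_q} | i0.-support f \subset T)
    \sum_(g : {ffun 'I_q -> 'S_m} | g \in ffun_on (mem G))
      \prod_i ((has_cycle_type w (g i) [set t in T | f t == i])%:R * phi i (g i))); last first.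
  apply: eq_bigr => f _.
  rewrite -(bigA_distr_big (mem G) (fun i s =>
    (has_cycle_type w s [set t in T | f t == i])%:R * phi i s)).
  apply: eq_bigr => i _; rewrite [RHS]big_mkcondr; apply: eq_bigr => s _.
  by case: ifP; rewrite ?mul1r ?mul0r.
rewrite exchange_big big_mkcondr /=; apply: eq_bigr => g _.
under [RHS]eq_bigr do rewrite big_split.
rewrite -[RHS]big_distrl -has_cycle_type_wr_perm1 /=.
by case: ifP; rewrite ?mul1r ?mul0r.
Qed.

End CycleTypeTop1.

Section FullTop.

Variable h : 'S_q.
Hypothesis full_h : full_cycle h.

Lemma card_porbit_full i : #|porbit h i| = q.
Proof.
rewrite (_ : porbit h i = setT) ?cardsT ?card_ord //.
by apply/setP=> k; rewrite inE (full_cycleP _ full_h).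
Qed.

Lemma full_cycle_permX_id i j : ((h ^+ j)%g i == i) = (q %| j)%N.
Proof. by rewrite -[X in _ == X]perm1 -(expg0 h) eq_permX_mod card_porbit_full mod0n. Qed.

Lemma full_cycle_permX_bij (i0 : 'I_q) : bijective (fun t : 'I_q => (h ^+ t)%g i0).
Proof.
apply: injF_bij => s t /eqP; rewrite eq_permX_mod card_porbit_full !modn_small //.
by move/eqP/val_inj.
Qed.

Definition cycle_prod (i0 : 'I_q) g : 'S_m := (\prod_(0 <= t < q) g ((h ^+ t)%g i0))%g.

Lemma wr_permX_cycle_prod g i0 c x :
  (wr_perm eN g h ^+ (q * c))%g (block eN i0 x) = block eN i0 ((cycle_prod i0 g ^+ c)%g x).
Proof.
elim: c => [|c IHc]; first by rewrite muln0 !perm1.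
rewrite mulnS addnC expgD permM IHc wr_permX wr_permE ffunE expgSr permM.
by congr block; apply/eqP; rewrite full_cycle_permX_id.
Qed.

Lemma wr_perm_full_neq g y : (1 < q)%N -> wr_perm eN g h y != y.
Proof.
move=> q1; rewrite -[y](blockK eN) wr_permE; apply: contraTneq q1.
move/(congr1 (block_index eN)); rewrite !block_indexK => /eqP.
by rewrite -[h]expg1 full_cycle_permX_id dvdn1 => /eqP->.
Qed.

(** A point returns to its block exactly at the multiples of q, and the q-th power acts on block i0
    as the cycle product; a full cycle on one block then reaches all blocks through [h]. *)
Lemma full_cycle_wr_perm g i0 :
  full_cycle (wr_perm eN g h) = full_cycle (cycle_prod i0 g).
Proof.
apply/full_cycleP/full_cycleP => [fW x y|fP y z].
  have /porbitP[j ej] := fW (block eN i0 x) (block eN i0 y).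
  have /dvdnP[c jE] : (q %| j)%N.
    rewrite -(full_cycle_permX_id i0); apply/eqP.
    by have := congr1 (block_index eN) ej; rewrite wr_permX wr_permE !block_indexK.
  move: ej; rewrite jE mulnC wr_permX_cycle_prod => /block_inj->.
  exact: mem_porbit.
suffices base x u : u \in porbit (wr_perm eN g h) (block eN i0 x).
  have := base (block_offset eN y) y; rewrite -eq_porbit_mem => /eqP->.
  exact: base.
rewrite -[u](blockK eN); move: (block_index eN u) (block_offset eN u) => i {}u.
have /porbitP[j ->] := full_cycleP _ full_h i0 i.
(* [v] is the point of block i0 that j further steps carry to the target. *)
pose v := ((\prod_(0 <= t < j) g ((h ^+ t)%g i0))^-1)%g u.
have /porbitP[c ec] := fP x v.
apply/porbitP; exists (q * c + j)%N.
rewrite expgD permM wr_permX_cycle_prod -ec wr_permX wr_permE ffunE.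
by rewrite /v permKV.
Qed.

Lemma prod_lin_char_cycle_prod (G : {group 'S_m}) (phi : 'CF(G)) i0 g :
  phi \is a linear_char -> (forall i, g i \in G) ->
  \prod_i phi (g i) = phi (cycle_prod i0 g).
Proof.
move=> lin_phi Gg; rewrite lin_char_prod // big_mkord.
exact: reindex (onW_bij _ (full_cycle_permX_bij i0)).
Qed.

(* Left multiplication of the entry of index i0 by x in G multiplies the      *)
(* cycle product by x, so that it is equidistributed over G.                  *)
Lemma sum_cycle_prod (G : {group 'S_m}) (i0 : 'I_q) (X : 'S_m -> algC) :
  \sum_(g : {ffun 'I_q -> 'S_m} | g \in ffun_on (mem G)) X (cycle_prod i0 g) =
  #|G|%:R ^+ q.-1 * \sum_(s in G) X s.
Proof.
have q0 : (0 < q)%N by apply: leq_ltn_trans (ltn_ord i0).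
have G0 : #|G|%:R != 0 :> algC by rewrite pnatr_eq0 -lt0n cardG_gt0.
pose shift (x : 'S_m) (g : {ffun 'I_q -> 'S_m}) :=
  [ffun i => if i == i0 then (x * g i)%g else g i].
have shiftK x : cancel (shift x) (shift x^-1%g).
  by move=> g; apply/ffunP=> i; rewrite !ffunE; case: eqP => // _; rewrite mulKg.
have shift_prod x g : cycle_prod i0 (shift x g) = (x * cycle_prod i0 g)%g.
  rewrite /cycle_prod [in LHS]big_ltn // [in RHS]big_ltn // ffunE perm1 eqxx -mulgA.
  congr (_ * (_ * _))%g.
  rewrite big_nat [RHS]big_nat; apply: eq_bigr => t /andP[t0 tq].
  by rewrite ffunE full_cycle_permX_id gtnNdvd.
have shift_sum x : x \in G ->
    \sum_(g : {ffun 'I_q -> 'S_m} | g \in ffun_on (mem G)) X (cycle_prod i0 g) =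
    \sum_(g : {ffun 'I_q -> 'S_m} | g \in ffun_on (mem G)) X (x * cycle_prod i0 g)%g.
  move=> Gx; rewrite (reindex_inj (can_inj (shiftK x))) /=.
  apply: eq_big => [g|g _]; last by rewrite shift_prod.
  apply/ffun_onP/ffun_onP => Gg i; have := Gg i; rewrite ffunE; case: eqP => // _.
    by rewrite groupMl.
  by rewrite groupMl.
(* A factor |G| is spent on summing over all shifts x in G; for each fixed g, the sum over x no
   longer depends on g. *)
apply: (mulfI G0); rewrite mulrA -exprS prednK //.
rewrite mulr_natl -sumr_const (eq_bigr _ shift_sum) exchange_big /=.
transitivity (\sum_(g : {ffun 'I_q -> 'S_m} | g \in ffun_on (mem G)) \sum_(s in G) X s).
  apply: eq_bigr => g /ffun_onP Gg; rewrite [RHS](reindex_inj (mulIg (cycle_prod i0 g))) /=.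
  apply: eq_bigl => x; rewrite groupMr //.
  by apply: group_prod => t _; apply: Gg.
by rewrite sumr_const card_ffun_on card_ord -natrX mulr_natl.
Qed.

End FullTop.

End WreathCycles.

(** * Sums over the Sylow subgroups *)

Section PsylTheory.

Variable p : nat.
Hypothesis p_pr : prime p.
Let p_gt0 := prime_gt0 p_pr.
Let p_gt1 := prime_gt1 p_pr.

Let c : 'S_p := perm (@ordS_inj p).

Let full_c : full_cycle c.
Proof.
have cX j (i : 'I_p) : (c ^+ j)%g i = ((i + j) %% p)%N :> nat.
  elim: j => [|j IHj]; first by rewrite perm1 addn0 modn_small.
  by rewrite expgSr permM permE /= IHj -addn1 modnDml addn1 addnS.
apply/full_cycleP=> x y; apply/porbitP; exists (p - x + y)%N.
apply: val_inj; rewrite /= cX addnA subnKC; last exact: ltnW.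
by rewrite modnDl modn_small.
Qed.

Lemma card_Psyl1 : #|Psyl1 p| = p.
Proof.
apply/eqP; rewrite eqn_dvd -[#|_|]/(#[c]%g); apply/andP; split.
  rewrite order_dvdn; apply/eqP/permP=> i; rewrite perm1.
  by apply/eqP; rewrite full_cycle_permX_id.
by rewrite -(full_cycle_permX_id full_c (Ordinal p_gt0)) expg_order perm1.
Qed.

(** A nontrivial element generates the group of prime order p, hence has the same orbits as the
    p-cycle. *)
Lemma full_cycle_Psyl1 h : h \in Psyl1 p -> full_cycle h = (h != 1%g).
Proof.
move=> Ph; apply/idP/idP => [fh|h1].
  apply: contraTneq p_gt1 => h1.
  have := full_cycle_permX_id fh (Ordinal p_gt0) 1.
  by rewrite h1 expg1n perm1 eqxx dvdn1 => /esym/eqP->.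
have e : <[h]>%g = <[c]>%g.
  apply/eqP; rewrite eqEcard cycle_subG [h \in _]Ph /= -[#|<[c]>%g|]/#|Psyl1 p| card_Psyl1.
  have := order_dvdG Ph; rewrite card_Psyl1.
  have /primeP[_ /[apply]] := p_pr; rewrite order_eq1 (negPf h1) /= => /eqP hp.
  by rewrite -[#|_|]/(#[h]%g) hp.
apply/full_cycleP=> x y; have := full_cycleP _ full_c x y.
by rewrite !porbit.unlock e.
Qed.

(** This is orthogonality to the trivial character, with the term at 1 removed. *)
Lemma sum_Psyl1_neq1 (psi : 'CF(Psyl1 p)) : psi \is a linear_char ->
  \sum_(h in Psyl1 p | h != 1%g) psi h = p%:R * (psi == 1)%:R - 1.
Proof.
move=> lin_psi; have /irrP[i psiE] := lin_char_irr lin_psi.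
have := cfdot_irr i 0; rewrite irr0 -psiE.
have -> : (i == 0) = (psi == 1) by rewrite psiE -irr0 (inj_eq irr_inj).
rewrite cfdotE card_Psyl1 => <-.
rewrite mulVKf ?pnatr_eq0 -?lt0n // [in RHS](bigD1 1%g) //=.
rewrite lin_char1 // cfun1E group1 conjC1 mulr1 [RHS]addrC addKr.
by apply: eq_bigr => h /andP[Ph _]; rewrite cfun1E Ph conjC1 mulr1.
Qed.

Lemma repunitS k : ((p ^ k.+1 - 1) %/ (p - 1) = (p ^ k - 1) %/ (p - 1) * p + 1)%N.
Proof.
have p1 : (0 < p - 1)%N by rewrite subn_gt0.
rewrite !subn1 !predn_exp -subn1 !mulKn // big_ord_recl expn0 addnC; congr (_ + _)%N.
by rewrite big_distrl; apply: eq_bigr => i _; rewrite /= expnSr.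
Qed.

(** C_k * p^k is the value of S(T) for a single full cycle of P_{p^k}. In this normalisation the
    ratio of successive values has a natural exponent, and its power of p is |P_{p^k}|^(p-1). *)
Lemma CvalS (u : seq bool) k :
  Cval p u k.+1 * p%:R ^+ k.+1 =
  (p%:R * (nth false u k)%:R - 1) * p%:R ^+ ((p ^ k - 1) %/ (p - 1) * p.-1) *
  (Cval p u k * p%:R ^+ k).
Proof.
have p0 : p%:R != 0 :> algC by rewrite pnatr_eq0 -lt0n.
rewrite /Cval big_ord_recr /= repunitS; set e := (_ %/ _)%N; set P := \prod_(_ < _) _.
rewrite !expfzDr // -!exprnN -!exprnP !mul2n -!addnn !exprD.
have -> : (p%:R : algC) ^+ (e * p) = p%:R ^+ (e * p.-1) * p%:R ^+ e.
  by rewrite -exprD -mulnSr prednK.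
rewrite !exprS expr0; set x := _ ^+ (e * p.-1); field.
by rewrite p0 expf_neq0.
Qed.

End PsylTheory.

Section WreathSum.

Variables (q m N : nat) (eN : N = (q * m)%N) (G : {group 'S_m}) (H : {group 'S_q}).
Hypothesis m_gt0 : (0 < m)%N.

Let wr_inj : injective (fun gh : {ffun 'I_q -> 'S_m} * 'S_q => wr_perm eN gh.1 gh.2).
Proof. by move=> [g h] [g' h'] /(wr_perm_inj m_gt0) /= [-> ->]. Qed.

Lemma sum_wreath (V : nmodType) (F : 'S_N -> V) :
  \sum_(s in wreath eN G H) F s =
  \sum_(h in H) \sum_(g : {ffun 'I_q -> 'S_m} | g \in ffun_on (mem G)) F (wr_perm eN g h).
Proof.
rewrite exchange_big pair_big_dep [LHS]big_imset //=.
  by apply: eq_bigl => gh; rewrite inE.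
by move=> x y _ _; apply: wr_inj.
Qed.

Lemma card_wreath : #|wreath eN G H| = (#|G| ^ q * #|H|)%N.
Proof.
rewrite -sum1_card sum_wreath; under eq_bigr do rewrite sum1_card card_ffun_on card_ord.
by rewrite sum_nat_const mulnC.
Qed.

End WreathSum.

Lemma card_Psyl p k : prime p -> #|Psyl p k| = (p ^ ((p ^ k - 1) %/ (p - 1)))%N.
Proof.
move=> p_pr; have p_gt0 := prime_gt0 p_pr.
elim: k => [|[|k] IHk]; first by rewrite cards1 subnn div0n.
  by rewrite [LHS]card_Psyl1 // expn1 divnn subn_gt0 prime_gt1 // expn1.
by rewrite [LHS]card_wreath ?expn_gt0 ?p_gt0 // IHk card_Psyl1 // [in RHS]repunitS // expnD expnM.
Qed.

Lemma sum_expn_lt p b (l : 'I_b -> nat) K (T : {set 'I_b}) :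
  (1 < p)%N -> (forall s t : 'I_b, (s < t)%N -> (l s < l t)%N) ->
  (forall t, t \in T -> (l t < K)%N) -> (\sum_(t in T) p ^ l t < p ^ K)%N.
Proof.
move=> p1 l_incr ltK.
(* The term p^a leaves room for a new smallest exponent: 2 * p^(l t0) is at most p^(l t0 + 1). *)
suffices: forall a, (a <= K)%N -> (forall t, t \in T -> (a <= l t)%N) ->
    (\sum_(t in T) p ^ l t + p ^ a <= p ^ K)%N.
  by move/(_ 0%N); rewrite addn1; apply.
elim/set_min_ind: T ltK => [|t0 T ltT IHT] ltK a aK lea.
  by rewrite big_set0 leq_exp2l.
have t0T : t0 \notin T by apply/negP=> /ltT; rewrite ltnn.
rewrite big_setU1 //= -addnA addnCA.
have := IHT (fun t Tt => ltK t (setU1r _ Tt)) (l t0).+1 (ltK t0 (setU11 _ _)).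
move/(_ (fun t Tt => l_incr _ _ (ltT t Tt))); apply: leq_trans; rewrite leq_add2l.
apply: (@leq_trans (2 * p ^ l t0)); last by rewrite expnS leq_mul2r p1 orbT.
by rewrite mul2n -addnn leq_add2l leq_exp2l // lea // setU11.
Qed.

(** * Character sums over a given cycle type *)

Section CycleTypeSums.

Variables (p b : nat) (l : 'I_b -> nat).
Hypotheses (p_pr : prime p) (l_gt0 : forall t, (0 < l t)%N).
Hypothesis l_incr : forall s t : 'I_b, (s < t)%N -> (l s < l t)%N.

Let p_gt0 := prime_gt0 p_pr.
Let p_gt1 := prime_gt1 p_pr.
Let w t := (p ^ l t)%N.
Let pw (t : 'I_b) : algC := (p ^ l t)%:R.
Let top (N : algC) := tail_prod pw N (fun _ _ => true).

Let l_inj : injective l.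
Proof.
move=> s t e; case: (ltngtP s t) => [/l_incr|/l_incr|/val_inj //].
  by rewrite e ltnn.
by rewrite e ltnn.
Qed.

Lemma cycle_length_gt1 t : (1 < w t)%N.
Proof. by rewrite -[1%N](expn0 p) ltn_exp2l. Qed.

Lemma cycle_length_inj : injective w.
Proof. by move=> s t /(expnI p_gt1)/l_inj. Qed.

Let w_gt1 := cycle_length_gt1.
Let w_inj := cycle_length_inj.

Lemma sum_cycle_type_Psyl1 (chi : 'CF(Psyl1 p)) (v : bool) (T : {set 'I_b}) :
  chi \is a linear_char -> v = (chi == 1) -> (forall t, t \in T -> (l t <= 1)%N) ->
  \sum_(s in Psyl1 p | has_cycle_type w s T) chi s = \prod_(t in T) (p%:R * v%:R - 1).
Proof.
move=> lin_chi -> lT; have [->|/set0Pn[t Tt]] := eqVneq T set0.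
  rewrite big_set0 (big_pred1 1%g) ?lin_char1 // => s.
  by rewrite has_cycle_type0 //=; case: eqP => [->|_]; rewrite ?group1 ?andbF.
have l1 s : s \in T -> l s = 1%N by move=> Ts; apply/eqP; rewrite eqn_leq lT ?l_gt0.
have -> : T = [set t].
  apply/setP=> s; rewrite inE; apply/idP/eqP => [Ts|-> //].
  by apply: l_inj; rewrite !l1.
rewrite big_set1 -sum_Psyl1_neq1 //; apply: eq_bigl => s.
case Ps: (s \in Psyl1 p) => //=; rewrite -full_cycle_Psyl1 // has_cycle_type1 //.
by rewrite /w l1 ?expn1.
Qed.

(** The largest element of [T] other than t has t as its only larger element, so its factor is p^K -
    p^K. *)
Lemma tail_prod_full_cycle K (T : {set 'I_b}) t :
  t \in T -> l t = K -> (forall s, s \in T -> (l s <= K)%N) -> T != [set t] ->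
  top (p ^ K)%:R T = 0.
Proof.
move=> Tt lt leK neqT.
have ltt s : s \in T -> s != t -> (s < t)%N.
  move=> Ts; rewrite ltn_neqAle => -> /=; rewrite leqNgt; apply/negP=> /l_incr.
  by rewrite lt ltnNge leK.
have [r0 Tr0] : exists r, r \in T :\ t.
  apply/set0Pn; apply: contraNneq neqT => T0.
  by rewrite -(setD1K Tt) T0 setU0.
case: (arg_maxnP (fun s : 'I_b => s : nat) Tr0) => r /setD1P[rt Tr] rmax.
apply/eqP; rewrite /top /tail_prod prodf_seq_eq0; apply/hasP; exists r.
  by rewrite mem_index_enum.
rewrite Tr subr_eq0 (big_pred1 t) => [|s /=]; first by rewrite /pw lt eqxx.
rewrite andbT.
apply/andP/eqP => [[Ts rs]|->]; last by rewrite Tt ltt.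
apply/eqP; apply: contraTT rs => st; rewrite -leqNgt.
by apply: rmax; apply/setD1P.
Qed.

Section Step.

Variables (m N : nat) (eN : N = (p * m)%N) (G : {group 'S_m}).
Variables (phi : 'CF(G)) (chi : 'CF(Psyl1 p)).
Hypotheses (m_gt0 : (0 < m)%N).
Hypotheses (lin_phi : phi \is a linear_char) (lin_chi : chi \is a linear_char).

Lemma sum_cycle_type_wreath (T : {set 'I_b}) :
  \sum_(s in wreath eN G (Psyl1 p) | has_cycle_type w s T)
     cfWreath eN (fun=> phi) chi s =
  \sum_(g : {ffun 'I_p -> 'S_m} |
      (g \in ffun_on (mem G)) && has_cycle_type w (wr_perm eN g 1) T) \prod_i phi (g i) +
  \sum_(h in Psyl1 p | h != 1%g) \sum_(g : {ffun 'I_p -> 'S_m} |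
      (g \in ffun_on (mem G)) && has_cycle_type w (wr_perm eN g h) T)
        (\prod_i phi (g i)) * chi h.
Proof.
rewrite big_mkcondr sum_wreath // (bigD1 1%g) //=; congr (_ + _).
  rewrite big_mkcondr; apply: eq_bigr => g /ffun_onP Gg.
  by rewrite cfWreathE // lin_char1 // mulr1.
apply: eq_bigr => h /andP[Ph _]; rewrite [RHS]big_mkcondr; apply: eq_bigr => g /ffun_onP Gg.
by rewrite cfWreathE.
Qed.

(** A trivial top preserves the blocks, so only nontrivial tops contribute. Each of them is a full
    cycle; the character then depends on the bottom only through the cycle product, which takes each
    value |G|^(p-1) times. *)
Lemma sum_full_cycle_wreath t : w t = N ->
  \sum_(s in wreath eN G (Psyl1 p) | has_cycle_type w s [set t])
     cfWreath eN (fun=> phi) chi s =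
  (p%:R * (chi == 1)%:R - 1) * (#|G|%:R ^+ p.-1 * \sum_(s in G | full_cycle s) phi s).
Proof.
move=> wt; rewrite sum_cycle_type_wreath big1 ?add0r => [|g /andP[_]]; last first.
  rewrite has_cycle_type1 // => /full_cycleP fW.
  have := fW (block eN (Ordinal p_gt0) (Ordinal m_gt0)) (block eN (Ordinal p_gt1) (Ordinal m_gt0)).
  by rewrite porbit_wr_perm1 => /imsetP[x _ /(congr1 (block_index eN))]; rewrite !block_indexK.
rewrite -sum_Psyl1_neq1 // mulr_suml; apply: eq_bigr => h /andP[Ph h1].
have full_h : full_cycle h by rewrite full_cycle_Psyl1.
rewrite -big_distrl mulrC; congr (_ * _).
rewrite [in RHS]big_mkcondr -(sum_cycle_prod full_h G (Ordinal p_gt0)) big_mkcondr.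
apply: eq_bigr => g /ffun_onP Gg.
rewrite has_cycle_type1 // (full_cycle_wr_perm eN full_h g (Ordinal p_gt0)).
by rewrite (prod_lin_char_cycle_prod full_h (Ordinal p_gt0)).
Qed.

(** Only the base group contributes. The cycles are distributed over the p blocks by a map f, each
    block gives its own tail product, and [sum_tail_prod] replaces p^K by p * p^K. *)
Lemma sum_cycle_type_wreath_lt (K : nat) (C : 'I_b -> algC) (T : {set 'I_b}) : m = (p ^ K)%N ->
  (forall t, t \in T -> (l t <= K)%N) ->
  (forall T' : {set 'I_b}, T' \subset T ->
    \sum_(s in G | has_cycle_type w s T') phi s =
      \prod_(t in T') C t * top (p ^ K)%:R T') ->
  \sum_(s in wreath eN G (Psyl1 p) | has_cycle_type w s T)
     cfWreath eN (fun=> phi) chi s =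
  \prod_(t in T) C t * top (p ^ K.+1)%:R T.
Proof.
move=> mE leK sumG; rewrite sum_cycle_type_wreath [X in _ + X]big1 ?addr0; last first.
  move=> h /andP[Ph h1]; rewrite big1 // => g /andP[_ /sum_has_cycle_type sT].
  (* With h != 1 there is no fixed point, but the cycle lengths sum to less   *)
  (* than p^(K + 1).                                                          *)
  have := sum_expn_lt p_gt1 l_incr (K := K.+1) (T := T) leK; rewrite sT.
  rewrite (_ : [set x | _] = setT); last first.
    by apply/setP=> y; rewrite !inE wr_perm_full_neq // full_cycle_Psyl1.
  by rewrite cardsT card_ord [X in (X < _)%N]eN [X in (p * X)%N]mE -expnS ltnn.
rewrite (sum_wr_perm1 eN w_gt1 w_inj (Ordinal p_gt0) G (fun=> phi)).
rewrite -[(p ^ K.+1)%:R](_ : (p ^ K)%:R *+ #|'I_p| = _); last first.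
  by rewrite card_ord expnSr natrM mulr_natr.
rewrite /top -(sum_tail_prod _ (Ordinal p_gt0)) mulr_sumr; apply: eq_bigr => f _.
rewrite -prod_tail_prod_fibres -(prod_fibres f) -big_split /=; apply: eq_bigr => i _.
by rewrite sumG //; apply/subsetP=> t; rewrite inE => /andP[].
Qed.

End Step.

End CycleTypeSums.

Lemma sum_cycle_type_cfX p b (l : 'I_b -> nat) k (u : seq bool) (psi : seq 'CF(Psyl1 p))
    (T : {set 'I_b}) :
  prime p -> (forall t, (0 < l t)%N) ->
  (forall s t : 'I_b, (s < t)%N -> (l s < l t)%N) ->
  (forall j, nth 1 psi j \is a linear_char) ->
  (forall j, (j <= k)%N -> nth false u j = (nth 1 psi j == 1)) ->
  (forall t, t \in T -> (l t <= k.+1)%N) ->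
  \sum_(s in Psyl p k.+1 | has_cycle_type (fun t => p ^ l t)%N s T) cfX psi k.+1 s =
  \prod_(t in T) Cval p u (l t) *
    tail_prod (fun t => (p ^ l t)%:R) (p ^ k.+1)%:R (fun _ _ => true) T.
Proof.
move=> p_pr + + lin_psi; have p_gt0 := prime_gt0 p_pr; have p_gt1 := prime_gt1 p_pr.
have lin_phi j : cfX psi j \is a linear_char.
  by apply: cfX_lin_char => //; apply/(all_nthP 1)=> i _; apply: lin_psi.
elim: k b l T => [|k IHk] b l T l_gt0 l_incr uE lT.
  have -> : \sum_(s in Psyl p 1 | has_cycle_type (fun t => p ^ l t)%N s T) cfX psi 1 s =
            \prod_(t in T) (p%:R * (nth false u 0)%:R - 1).
    exact: (sum_cycle_type_Psyl1 p_pr l_gt0 l_incr (lin_psi 0%N) (uE 0%N _) lT).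
  have C1 : Cval p u 1 * p%:R = p%:R * (nth false u 0)%:R - 1.
    rewrite -[p%:R in LHS]expr1 (CvalS p_pr) expn0 subnn div0n mul0n !expr0 !mulr1.
    by rewrite /Cval expn0 subnn div0n muln0 subrr expr0z big_ord0 !mulr1.
  have lT1 t : t \in T -> l t = 1%N by move=> Tt; apply/eqP; rewrite eqn_leq lT ?l_gt0.
  rewrite /tail_prod -big_split; apply: eq_bigr => t Tt /=.
  rewrite lT1 // big1 ?subr0 ?expn1 ?C1 // => s /andP[Ts /andP[/l_incr]].
  by rewrite !lT1.
have m_gt0 : (0 < p ^ k.+1)%N by rewrite expn_gt0 p_gt0.
have [/exists_inP[t Tt /eqP lt]|noT] := boolP [exists t in T, l t == k.+2]; last first.
  have {}lT t : t \in T -> (l t <= k.+1)%N.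
    move=> Tt; rewrite -ltnS ltn_neqAle lT // andbT; apply: contra noT => lt.
    by apply/exists_inP; exists t.
  apply: (sum_cycle_type_wreath_lt p_pr l_gt0 l_incr (expnS p k.+1) m_gt0
            (lin_phi k.+1) (lin_psi k.+1) (erefl _) lT) => T' T'T.
  apply: (IHk b l T' l_gt0 l_incr) => [j lejk|t /(subsetP T'T)/lT //].
  exact/uE/leqW.
(* A cycle of length p^(k+2) moves every point, so a further element of [T] makes both sides
   vanish. *)
have [->|neqT] := eqVneq T [set t]; last first.
  rewrite (tail_prod_full_cycle _ l_incr Tt lt lT neqT) mulr0.
  apply: big1 => s /andP[_ /sum_has_cycle_type sT].
  have : (\sum_(r in T) p ^ l r <= p ^ k.+2)%N.
    by rewrite sT -[X in (_ <= X)%N]card_ord max_card.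
  rewrite (bigD1 t) //= lt -[X in (_ <= X)%N]addn0 leq_add2l leqn0 sum_nat_eq0.
  move/forall_inP=> T0; case/eqP: neqT; apply/setP=> r; rewrite inE.
  apply/idP/eqP => [Tr|-> //]; apply/eqP/negPn/negP => rt.
  by have := T0 r; rewrite Tr rt expn_eq0 eqn0Ngt p_gt0 => /(_ isT).
(* The full cycles one level down have length p^(k+1), which need not be among the given lengths;
   the induction hypothesis is therefore used for a one-term family of its own. *)
have incr1 (r s : 'I_1) : (r < s)%N -> (k.+1 < k.+1)%N by rewrite !ord1.
have := IHk 1%N (fun=> k.+1) [set ord0] (fun=> isT) incr1
          (fun j lejk => uE j (leqW lejk)) (fun _ _ => leqnn _).
rewrite !big_set1 !tail_prod1 lt => IH.
rewrite [LHS](sum_full_cycle_wreath p_pr l_gt0 (expnS p k.+1) m_gt0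
                (lin_phi k.+1) (lin_psi k.+1)) ?lt //.
rewrite natrX CvalS // uE // -mulrA; congr (_ * (_ * _)).
  by rewrite card_Psyl // natrX exprM.
rewrite -natrX -{}IH; apply: eq_bigl => s; rewrite has_cycle_type1 // => _.
by rewrite -[1%N](expn0 p) ltn_exp2l.
Qed.

(** * Induced characters and the final assembly *)

Lemma cfInd_sum_class (gT : finGroupType) (G H : {group gT}) (phi : 'CF(H)) g :
  H \subset G -> g \in G ->
  #|H|%:R / #|'C_G[g]%g|%:R * 'Ind[G] phi g = \sum_(h in H | h \in (g ^: G)%g) phi h.
Proof.
move=> sHG Gg; have C0 : #|'C_G[g]%g|%:R != 0 :> algC by rewrite pnatr_eq0 -lt0n cardG_gt0.
have H0 : #|H|%:R != 0 :> algC by rewrite pnatr_eq0 -lt0n cardG_gt0.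
rewrite cfIndE // mulrACA divff // mul1r; apply: (canLR (mulKf C0)).
rewrite (partition_big (fun y => g ^ y)%g (mem (g ^: G)%g)) => [|y Gy] /=; last first.
  exact: memJ_class.
rewrite mulr_sumr [RHS]big_mkcond [LHS]big_mkcond; apply: eq_bigr => h _.
case: ifPn => [gh|_]; last by rewrite andbF.
rewrite andbT; have /imsetP[x Gx hE] := gh.
rewrite (eq_bigr (fun=> phi h)) => [|y /andP[_ /eqP->] //].
rewrite sumr_const -[LHS]mulr_natl (_ : #|_| = #|'C_G[g]%g|).
  by case: ifPn => // Hh; rewrite cfun0 ?mulr0.
(* The y that conjugate g to h form a coset of the centraliser of g. *)
rewrite -(card_rcoset _ x); apply: eq_card => y.
rewrite mem_rcoset inE groupMr ?groupV // unfold_in /= hE; congr (_ && _).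
apply/eqP/cent1P => [e|/commute_sym/commgP/conjg_fixP e].
  by apply/commute_sym/commgP/conjg_fixP; rewrite conjgM e -conjgM mulgV conjg1.
by rewrite -{2}e -conjgM mulgKV.
Qed.

Theorem theorem4p13 (p k a b : nat) (l : 'I_b -> nat)
    (u : 'I_a -> k.-tuple bool)
    (psi : 'I_a -> k.-tuple 'CF(Psyl1 p))
    (g : 'S_(a * p ^ k))
    (p_prime : prime p)
    (a_bounds : (1 <= a <= p - 1)%N)
    (b_bounds : (1 <= b <= a)%N)
    (l_bounds : forall t, (1 <= l t <= k)%N)
    (l_incr : forall s t : 'I_b, (s < t)%N -> (l s < l t)%N)
    (psi_lin : forall i j, tnth (psi i) j \is a linear_char)
    (psi_u : forall i j, tnth (u i) j = true <-> tnth (psi i) j = 1)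
    (g_type : perm_eq (cycle_lengths g) [seq (p ^ l t)%N | t : 'I_b]) :
  #|PsylM p a k|%:R / #|'C[g]%g|%:R *
    'Ind[[set: 'S_(a * p ^ k)]%G, PsylM p a k] (cfXM psi) g =
  \sum_(nu : {set {set 'I_b}} | partition nu [set: 'I_b])
    (-1) ^+ (b - #|nu|) * p%:R ^+ (k * #|nu|) *
    \prod_(tau in nu)
      ((Mval p l tau)%:R *
       \sum_(i < a) \prod_(t in tau) Cval p (u i) (l t)).
Proof.
have p_gt0 := prime_gt0 p_prime; have p_gt1 := prime_gt1 p_prime.
have [a_gt0 _] := andP a_bounds; have [b_gt0 _] := andP b_bounds.
have l_gt0 t : (0 < l t)%N by have /andP[] := l_bounds t.
have w_gt1 := cycle_length_gt1 p_prime l_gt0.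
have w_inj := cycle_length_inj p_prime l_incr.
have gT : has_cycle_type (fun t => p ^ l t)%N g [set: 'I_b].
  rewrite /has_cycle_type (eq_image (_ : _ =i predT) (fun=> erefl)) // => t.
  by rewrite inE.
have k_gt0 : (0 < k)%N.
  by have /andP[] := l_bounds (Ordinal b_gt0); apply: leq_trans.
have lin_nth i j : nth 1 (psi i) j \is a linear_char.
  have [ltj|gej] := ltnP j k; first by rewrite -(tnth_nth _ _ (Ordinal ltj)).
  by rewrite nth_default ?size_tuple // cfun1_lin_char.
have uE i j : (j <= k.-1)%N -> nth false (u i) j = (nth 1 (psi i) j == 1).
  rewrite -ltnS prednK // => ltj.
  rewrite -!(tnth_nth _ _ (Ordinal ltj)); apply/idP/eqP => /psi_u //.
have lin_cfX i : cfX (psi i) k \is a linear_char.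
  by apply: cfX_lin_char => //; apply/all_tnthP.
transitivity (\sum_(h in PsylM p a k | has_cycle_type (fun t => p ^ l t)%N h [set: 'I_b])
                cfXM psi h).
  rewrite -(setTI 'C[g]%g) [LHS]cfInd_sum_class ?subsetT ?inE //; apply: eq_bigl => h.
  by rewrite (has_cycle_type_conj w_gt1 _ gT).
have m_gt0 : (0 < p ^ k)%N by rewrite expn_gt0 p_gt0.
rewrite big_mkcondr sum_wreath // big_set1.
transitivity (\sum_(h : {ffun 'I_a -> 'S_(p ^ k)} | (h \in ffun_on (mem (Psyl p k))) &&
    has_cycle_type (fun t => p ^ l t)%N (wr_perm (erefl (a * p ^ k)%N) h 1) [set: 'I_b])
    \prod_i cfX (psi i) k (h i)).
  rewrite [RHS]big_mkcondr; apply: eq_bigr => h /ffun_onP Ph; case: ifP => // _.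
  rewrite /cfXM cfWreathE ?cfun1_lin_char ?cfun11 ?mulr1 // => s i /set1P->.
  by rewrite perm1.
rewrite (sum_wr_perm1 _ w_gt1 w_inj (Ordinal a_gt0) (Psyl p k) (fun i s => cfX (psi i) k s)).
(* The support condition is vacuous for the full index set: all maps from [b] to [a] occur. *)
rewrite [LHS](eq_bigl predT) => [|f]; last exact/subsetP.
under [RHS]eq_bigr do rewrite exprM -natrX.
rewrite (sum_partition_tail_prod _ _ _ (Ordinal a_gt0) (fun t i => Cval p (u i) (l t))).
apply: eq_bigr => f _; rewrite -prod_tail_prod_fibres.
(* The factors C_t(f t) are regrouped along the fibres of f, so that both sides become products over
   the a factors P_{p^k}. *)
rewrite -[X in X * _](_ : \prod_i \prod_(t in [set t in [set: 'I_b] | f t == i])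
  Cval p (u (f t)) (l t) = _); last first.
  by rewrite prod_fibres; apply: eq_bigl => t; rewrite inE.
rewrite -big_split /=; apply: eq_bigr => i _.
have := sum_cycle_type_cfX p_prime l_gt0 l_incr (lin_nth i) (uE i)
  (T := [set t in [set: 'I_b] | f t == i]).
rewrite (prednK k_gt0) => ->; last by move=> t _; have /andP[] := l_bounds t.
by congr (_ * _); apply: eq_bigr => t; rewrite inE => /andP[_ /eqP->].
Qed.
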